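(* Let $k$ be a commutative ring such that $\mathrm{sfli}\,k<\infty$ and let $G$ be a group such that there exists a weak characteristic module for $G$ over $k$. Then a $kG$-module $M$ is Gorenstein flat if and only if its Pontryagin dual $DM$ is Gorenstein injective.
   Context: Rings are associative and unital; modules are left modules unless otherwise specified. For a ring $R$, $\mathrm{sfli}\,R$ is the supremum of the flat dimensions of all injective left $R$-modules. The Pontryagin dual of a left $R$-module $M$ is the right $R$-module $DM=\mathrm{Hom}_{\mathbb{Z}}(M,\mathbb{Q}/\mathbb{Z})$ (right $kG$-modules may be viewed as left ones via the anti-isomorphism $g\mapsto g^{-1}$ of $kG$). A weak characteristic module for $G$ over $k$ is a $kG$-module $A$ which is flat as a $k$-module, has $\mathrm{fd}_{kG}A<\infty$, and admits a $kG$-linear monomorphism $\iota:k\to A$ from the trivial $kG$-module $k$ which is pure as a monomorphism of $k$-modules. A module is Gorenstein flat if it is a syzygy of an acyclic (exact, unbounded) complex $\mathbf{F}$ of flat modules such that $I\otimes_R\mathbf{F}$ is acyclic for every injective right module $I$. A module is Gorenstein injective if it is a syzygy of an acyclic complex $\mathbf{I}$ of injective modules such that $\mathrm{Hom}_R(J,\mathbf{I})$ is acyclic for every injective module $J$. *)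

(* Defs.v *)
From HB Require Import structures.
From mathcomp Require Import all_boot all_order all_algebra.
From mathcomp Require Import finmap generic_quotient ring_quotient.
From mathcomp Require Import boolp.
From mathcomp.multinomials Require Import monalg.

Set Implicit Arguments.
Unset Strict Implicit.
Unset Printing Implicit Defensive.

Import GRing.Theory Num.Theory.
Local Open Scope quotient_scope.
Local Open Scope ring_scope.

(* Conventions.  Left R-modules are [lmodType R]; right R-modules are modules
   over the converse ring, i.e. [lmodType R^c], so that the right action m.r
   is written [(r : R^c) *: m].  All modules live in the (fixed) universe of
   MathComp's [lmodType]. *)

Section MalgSum.
Variables (K : choiceType) (A V : zmodType) (F : K -> A -> V).
Hypothesis F_add : forall k, zmod_morphism (F k).

Lemma malg_sumw (g : {malg A[K]}) (d : {fset K}) :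
  (msupp g `<=` d)%fset ->
  \sum_(k <- msupp g) F k (g@_k) = \sum_(k <- d) F k (g@_k).
Proof.
move=> gd; apply: big_fset_incl => // k _ /mcoeff_outdom ->.
by rewrite -[X in F k X](subrr 0) F_add subrr.
Qed.

Lemma malg_sumB :
  zmod_morphism (fun g : {malg A[K]} => \sum_(k <- msupp g) F k (g@_k)).
Proof.
move=> g h /=; rewrite (malg_sumw (msuppB_le g h)).
rewrite (malg_sumw (fsubsetUl (msupp g) (msupp h))).
rewrite (malg_sumw (fsubsetUr (msupp g) (msupp h))).
by rewrite -sumrB; apply: eq_bigr => k _; rewrite mcoeffB F_add.
Qed.

Lemma malg_sumU k a : \sum_(l <- msupp << a *g k >>) F l (<< a *g k >>@_l) = F k a.
Proof. by rewrite (malg_sumw msuppU_le) big_seq_fset1 mcoeffUU. Qed.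

End MalgSum.

(* The ring structure that [monalg] puts on {malg k[G]} requires a monoid
   without nontrivial units (and 0 != 1 in k), so the convolution product is
   put here on a copy of the same additive group. *)
Definition group_ring (k : comPzRingType) (G : groupType) : Type := {malg k[G]}.

Section GroupRing.
Variables (k : comPzRingType) (G : groupType).
Local Notation kG := (group_ring k G).

HB.instance Definition _ := GRing.Zmodule.on kG.

Definition gr_monom (c : k) (g : G) : kG := << c *g g >>.

Definition gr_one : kG := gr_monom 1 1%g.

Definition gr_mul (x y : kG) : kG :=
  \sum_(g <- msupp x) \sum_(h <- msupp y) gr_monom (x@_g * y@_h) (g * h)%g.

Lemma gr_monomB g : zmod_morphism (gr_monom^~ g).
Proof. exact: monalgUB. Qed.

Lemma gr_mulBl y : zmod_morphism (gr_mul^~ y).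
Proof.
apply: (@malg_sumB _ _ _
  (fun g c => \sum_(h <- msupp y) gr_monom (c * y@_h) (g * h)%g)) => g a b.
by rewrite -sumrB; apply: eq_bigr => h _; rewrite mulrBl gr_monomB.
Qed.

Lemma gr_mulC2 x y :
  gr_mul x y =
  \sum_(h <- msupp y) \sum_(g <- msupp x) gr_monom (x@_g * y@_h) (g * h)%g.
Proof. exact: exchange_big. Qed.

Lemma gr_mulBr x : zmod_morphism (gr_mul x).
Proof.
move=> y z; rewrite !gr_mulC2.
apply: (@malg_sumB _ _ _
  (fun h c => \sum_(g <- msupp x) gr_monom (x@_g * c) (g * h)%g)) => h a b.
by rewrite -sumrB; apply: eq_bigr => g _; rewrite mulrBr gr_monomB.
Qed.

Definition gr_mulr y x : kG := gr_mul x y.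
HB.instance Definition _ y :=
  GRing.isZmodMorphism.Build kG kG (gr_mulr y) (gr_mulBl y).
HB.instance Definition _ x :=
  GRing.isZmodMorphism.Build kG kG (gr_mul x) (gr_mulBr x).

Lemma gr_mulUU c d g h :
  gr_mul (gr_monom c g) (gr_monom d h) = gr_monom (c * d) (g * h)%g.
Proof.
rewrite /gr_mul (@malg_sumU _ _ _
  (fun g' c' => \sum_(h' <- msupp _) gr_monom (c' * _@_h') (g' * h')%g)); last first.
  move=> g' a b; rewrite -sumrB; apply: eq_bigr => h' _.
  by rewrite mulrBl gr_monomB.
rewrite (@malg_sumU _ _ _ (fun h' d' => gr_monom (c * d') (g * h')%g)) //.
by move=> h' a b; rewrite mulrBr gr_monomB.
Qed.

Lemma gr_sumE (x : kG) : x = \sum_(g <- msupp x) gr_monom (x@_g) g.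
Proof. exact: monalgE. Qed.

Lemma gr_ind (P : kG -> Prop) :
  P 0 -> (forall x y, P x -> P y -> P (x + y)) ->
  (forall c g, P (gr_monom c g)) -> forall x, P x.
Proof. by move=> P0 PD PU x; rewrite (gr_sumE x); apply: big_ind. Qed.

Lemma gr_mul0 : left_zero 0 gr_mul.
Proof. by move=> x; apply: (raddf0 (gr_mulr x)). Qed.

Lemma gr_mulDl : left_distributive gr_mul +%R.
Proof. by move=> x y z; apply: (raddfD (gr_mulr z)). Qed.

Lemma gr_mulDr : right_distributive gr_mul +%R.
Proof. by move=> x y z; apply: (raddfD (gr_mul x)). Qed.

Lemma gr_mulr0 : right_zero 0 gr_mul.
Proof. by move=> x; apply: (raddf0 (gr_mul x)). Qed.

Lemma gr_mulA : associative gr_mul.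
Proof.
move=> x y z; elim/gr_ind: x => [|x1 x2 H1 H2|c g].
- by rewrite !gr_mul0.
- by rewrite !gr_mulDl H1 H2.
elim/gr_ind: y => [|y1 y2 H1 H2|d h].
- by rewrite gr_mulr0 !gr_mul0 gr_mulr0.
- by rewrite !(gr_mulDl, gr_mulDr) H1 H2.
elim/gr_ind: z => [|z1 z2 H1 H2|e l].
- by rewrite !gr_mulr0.
- by rewrite !gr_mulDr H1 H2.
by rewrite !gr_mulUU mulrA mulgA.
Qed.

Lemma gr_mul1 : left_id gr_one gr_mul.
Proof.
elim/gr_ind => [|x y Hx Hy|c g]; first exact: gr_mulr0.
  by rewrite gr_mulDr Hx Hy.
by rewrite gr_mulUU mul1r mul1g.
Qed.

Lemma gr_mulr1 : right_id gr_one gr_mul.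
Proof.
elim/gr_ind => [|x y Hx Hy|c g]; first exact: gr_mul0.
  by rewrite gr_mulDl Hx Hy.
by rewrite gr_mulUU mulr1 mulg1.
Qed.

HB.instance Definition _ := GRing.Zmodule_isPzRing.Build kG
  gr_mulA gr_mul1 gr_mulr1 gr_mulDl gr_mulDr.

Lemma gr_monomM c d g h :
  gr_monom c g * gr_monom d h = gr_monom (c * d) (g * h)%g.
Proof. exact: gr_mulUU. Qed.

Definition gr_const (c : k) : kG := gr_monom c 1%g.

Lemma gr_constB : zmod_morphism gr_const.
Proof. exact: gr_monomB. Qed.

Lemma gr_constM : monoid_morphism gr_const.
Proof. by split=> // c d; rewrite /gr_const gr_monomM mulg1. Qed.

HB.instance Definition _ := GRing.isZmodMorphism.Build k kG gr_const gr_constB.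
HB.instance Definition _ := GRing.isMonoidMorphism.Build k kG gr_const gr_constM.

Definition gr_aug (x : kG) : k := \sum_(g <- msupp x) x@_g.

Lemma gr_augB : zmod_morphism gr_aug.
Proof. exact: (@malg_sumB _ _ _ (fun _ c => c)). Qed.

HB.instance Definition _ := GRing.isZmodMorphism.Build kG k gr_aug gr_augB.

Lemma gr_augU c g : gr_aug (gr_monom c g) = c.
Proof. exact: (@malg_sumU _ _ _ (fun _ c => c)). Qed.

Lemma gr_augM : monoid_morphism gr_aug.
Proof.
split=> [|x y]; first exact: gr_augU.
elim/gr_ind: x => [|x1 x2 H1 H2|c g].
- by rewrite mul0r raddf0 mul0r.
- by rewrite mulrDl !raddfD /= H1 H2 mulrDl.
elim/gr_ind: y => [|y1 y2 H1 H2|d h].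
- by rewrite mulr0 raddf0 mulr0.
- by rewrite mulrDr !raddfD /= H1 H2 mulrDr.
by rewrite gr_monomM !gr_augU.
Qed.

HB.instance Definition _ := GRing.isMonoidMorphism.Build kG k gr_aug gr_augM.

End GroupRing.

Definition restr (R S : pzRingType) (phi : {rmorphism R -> S})
  (V : lmodType S) : Type := V.

Section Restriction.
Variables (R S : pzRingType) (phi : {rmorphism R -> S}).

Section Module.
Variable V : lmodType S.
Local Notation rV := (restr phi V).

HB.instance Definition _ := GRing.Zmodule.on rV.

Definition restr_scale (r : R) (v : rV) : rV := phi r *: (v : V).

Lemma restr_scaleA r s v :
  restr_scale r (restr_scale s v) = restr_scale (r * s) v.
Proof. by rewrite /restr_scale scalerA rmorphM. Qed.
Lemma restr_scale1 : left_id 1 restr_scale.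
Proof. by move=> v; rewrite /restr_scale rmorph1 scale1r. Qed.
Lemma restr_scaleDr : right_distributive restr_scale +%R.
Proof. by move=> r u v; apply: scalerDr. Qed.
Lemma restr_scaleDl v : {morph restr_scale^~ v : r s / r + s}.
Proof. by move=> r s; rewrite /restr_scale rmorphD scalerDl. Qed.

HB.instance Definition _ := GRing.Zmodule_isLmodule.Build R rV
  restr_scaleA restr_scale1 restr_scaleDr restr_scaleDl.
End Module.

Definition restr_map (V W : lmodType S) (f : {linear V -> W}) :
  restr phi V -> restr phi W := f.

Section Map.
Variables (V W : lmodType S) (f : {linear V -> W}).

Lemma restr_mapB : zmod_morphism (restr_map f).
Proof. exact: (raddfB f). Qed.
Lemma restr_mapZ : scalable (restr_map f).
Proof. by move=> r v; apply: (linearZZ f (phi r) v). Qed.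

HB.instance Definition _ := GRing.isZmodMorphism.Build
  (restr phi V) (restr phi W) (restr_map f) restr_mapB.
HB.instance Definition _ := GRing.isScalable.Build R
  (restr phi V) (restr phi W) _ (restr_map f) restr_mapZ.
End Map.
End Restriction.

Arguments restr_map {R S} phi {V W} f.

Section GroupRingModules.
Variables (k : comPzRingType) (G : groupType).

Definition base_module (V : lmodType (group_ring k G)) : lmodType k :=
  restr (@gr_const k G) V.

Definition base_map (V W : lmodType (group_ring k G)) (f : {linear V -> W}) :
  {linear base_module V -> base_module W} := restr_map (@gr_const k G) f.

(* Each g in G acts trivially since [gr_aug (gr_monom 1 g) = 1]. *)
Definition trivial_module : lmodType (group_ring k G) :=
  restr (@gr_aug k G) k^o.

End GroupRingModules.

Section Tensor.
Variables (R : pzRingType) (M : lmodType R^c) (N : lmodType R).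
Local Notation free := {malg int[(M * N)%type]}.

Definition tensor_relators (x : free) : Prop :=
  [\/ exists m m' n, x = << (m + m', n) >> - << (m, n) >> - << (m', n) >>,
      exists m n n', x = << (m, n + n') >> - << (m, n) >> - << (m, n') >>
    | exists m (r : R) n, x = << ((r : R^c) *: m, n) >> - << (m, r *: n) >>].

(* The subgroup generated by the relators, as the intersection of all the
   subgroups that contain them. *)
Definition tensor_ideal : pred free := fun x =>
  `[< forall S : zmodClosed free,
        (forall y, tensor_relators y -> y \in S) -> x \in S >].

Lemma tensor_ideal_closed : zmod_closed tensor_ideal.
Proof.
split=> [|x y]; rewrite !unfold_in.
  by apply/asboolP => S _; apply: rpred0.
move=> /asboolP Hx /asboolP Hy; apply/asboolP => S HS.
by apply: rpredB; [apply: Hx | apply: Hy].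
Qed.

HB.instance Definition _ :=
  GRing.isZmodClosed.Build free tensor_ideal tensor_ideal_closed.

Definition tensor_subgroup : zmodClosed free :=
  GRing.ZmodClosed.clone free tensor_ideal _.

Definition tensor : zmodType := {ideal_quot tensor_subgroup}.

Definition tens (m : M) (n : N) : tensor := \pi_({ideal_quot tensor_subgroup}) << (m, n) >>.

Definition balanced (V : zmodType) (f : M -> N -> V) : Prop :=
  [/\ forall m m' n, f (m + m') n = f m n + f m' n,
      forall m n n', f m (n + n') = f m n + f m n'
    & forall m (r : R) n, f ((r : R^c) *: m) n = f m (r *: n)].

(* The map M (x) N -> V induced by f, computed on a representative; it is
   meaningful only if f is balanced, see [tensor_liftE] and [tensor_liftB]. *)
Definition tensor_lift (V : zmodType) (f : M -> N -> V) (t : tensor) : V :=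
  let x : free := repr t in \sum_(p <- msupp x) f p.1 p.2 *~ x@_p.

Lemma tens_balanced : balanced tens.
Proof.
have rel x : tensor_relators x -> x \in tensor_ideal.
  by move=> rx; rewrite unfold_in; apply/asboolP => S; apply.
have eqpi (x y : free) : tensor_relators (x - y) ->
    \pi_({ideal_quot tensor_subgroup}) x = \pi_({ideal_quot tensor_subgroup}) y.
  by move=> /rel; rewrite Quotient.idealrBE => /eqP.
split=> [m m' n|m n n'|m r n]; rewrite /tens -?[_ + _ in RHS]raddfD.
- by apply: eqpi; apply: Or31; exists m, m', n; rewrite opprD addrA.
- by apply: eqpi; apply: Or32; exists m, n, n'; rewrite opprD addrA.
- by apply: eqpi; apply: Or33; exists m, r, n.
Qed.

Section Universal.
Variables (V : zmodType) (f : M -> N -> V).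
Hypothesis f_bal : balanced f.

Let ext (x : free) : V := \sum_(p <- msupp x) f p.1 p.2 *~ x@_p.

Let extB : zmod_morphism ext.
Proof.
by apply: (@malg_sumB _ _ _ (fun p c => f p.1 p.2 *~ c)) => p a b; apply: mulrzBr.
Qed.

Let extU p : ext << p >> = f p.1 p.2.
Proof.
rewrite /ext (@malg_sumU _ _ _ (fun p c => f p.1 p.2 *~ c)) //.
by move=> q a b; apply: mulrzBr.
Qed.

Let ext_ideal x : x \in tensor_ideal -> ext x = 0.
Proof.
pose K : free -> bool := fun x => ext x == 0.
have K_closed : zmod_closed K.
  split=> [|y z]; rewrite !unfold_in /K.
    by rewrite -[X in ext X](subrr 0) extB subrr.
  by rewrite extB => /eqP-> /eqP->; rewrite subrr.
pose S : zmodClosed free := HB.pack K (GRing.isZmodClosed.Build free K K_closed).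
rewrite unfold_in => /asboolP /(_ S) H; apply/eqP; apply: H => y.
have [fl fr fs] := f_bal.
case=> [[m [m' [n ->]]]|[m [n [n' ->]]]|[m [r [n ->]]]]; apply/eqP;
  rewrite !extB !extU /=.
- by rewrite fl addrAC addrK subrr.
- by rewrite fr addrAC addrK subrr.
- by rewrite fs subrr.
Qed.

Let ext_repr (x : free) : ext (repr (\pi_({ideal_quot tensor_subgroup}) x)) = ext x.
Proof.
apply/eqP; rewrite -subr_eq0 -extB; apply/eqP/ext_ideal.
by rewrite Quotient.idealrBE reprK.
Qed.

Lemma tensor_liftE m n : tensor_lift f (tens m n) = f m n.
Proof. by rewrite -[RHS](extU (m, n)) -ext_repr. Qed.

Lemma tensor_liftB : zmod_morphism (tensor_lift f).
Proof.
move=> s t; rewrite -[s]reprK -[t]reprK -raddfB.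
by rewrite /tensor_lift -!/(ext _) !ext_repr extB.
Qed.

End Universal.
End Tensor.

Arguments tens {R M N} m n.

Lemma tensor_map_balanced (R : pzRingType) (M M' : lmodType R^c)
    (N N' : lmodType R) (f : {linear M -> M'}) (g : {linear N -> N'}) :
  balanced (fun m n => tens (f m) (g n)).
Proof.
have [tl tr ts] := @tens_balanced R M' N'.
split=> [m m' n|m n n'|m r n]; first by rewrite raddfD tl.
  by rewrite raddfD tr.
by rewrite !linearZZ ts.
Qed.

Definition tensor_map (R : pzRingType) (M M' : lmodType R^c)
    (N N' : lmodType R) (f : {linear M -> M'}) (g : {linear N -> N'}) :
  tensor M N -> tensor M' N' :=
  tensor_lift (fun m n => tens (f m) (g n)).

Definition exact_at (A B C : zmodType) (f : A -> B) (g : B -> C) : Prop :=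
  forall b, g b = 0 <-> exists a, f a = b.

Definition injective_module (R : pzRingType) (E : lmodType R) : Prop :=
  forall (A B : lmodType R) (i : {linear A -> B}) (g : {linear A -> E}),
    injective i -> exists h : {linear B -> E}, forall a, h (i a) = g a.

Section Homological.
Variable R : pzRingType.
Implicit Types M N : lmodType R.

Definition flat_module N : Prop :=
  forall (A B : lmodType R^c) (f : {linear A -> B}),
    injective f -> injective (tensor_map f (idfun : {linear N -> N})).

Definition pure_mono M N (f : {linear M -> N}) : Prop :=
  injective f /\
  forall X : lmodType R^c,
    injective (tensor_map (idfun : {linear X -> X}) f).

(* fd M <= n: there is an exact sequence
   0 -> F n -> ... -> F 0 -> M -> 0 with all F i flat. *)
Definition fd_le M (n : nat) : Prop :=
  exists (F : nat -> lmodType R) (d : forall i, {linear F i.+1 -> F i})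
         (e : {linear F 0 -> M}),
    [/\ forall i, flat_module (F i),
        forall i, (n < i)%N -> forall x : F i, x = 0,
        forall m, exists x, e x = m,
        exact_at (d 0) e
      & forall i, exact_at (d i.+1) (d i)].

Definition fd_finite M : Prop := exists n, fd_le M n.

Definition sfli_le (n : nat) : Prop :=
  forall I : lmodType R, injective_module I -> fd_le I n.

Definition sfli_finite : Prop := exists n, sfli_le n.

(* Indexed homologically; [1 + i] rather than [i + 1] because [1 + Posz n]
   reduces to [Posz n.+1]. *)
Record complex := Complex {
  cobj :> int -> lmodType R;
  cdiff : forall i, {linear cobj (1 + i) -> cobj i};
  cdiffK : forall i x, cdiff i (cdiff (1 + i) x) = 0 }.

Definition acyclic (F : complex) : Prop :=
  forall i, exact_at (cdiff F (1 + i)) (cdiff F i).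

Definition tensor_acyclic (X : lmodType R^c) (F : complex) : Prop :=
  forall i, exact_at (tensor_map (idfun : {linear X -> X}) (cdiff F (1 + i)))
                     (tensor_map (idfun : {linear X -> X}) (cdiff F i)).

(* Acyclicity of Hom_R(J, F): exactness at each Hom_R(J, F (1 + i)). *)
Definition hom_acyclic (J : lmodType R) (F : complex) : Prop :=
  forall i (g : {linear J -> F (1 + i)}),
    (forall x, cdiff F i (g x) = 0) <->
    exists h : {linear J -> F (1 + (1 + i))},
      forall x, cdiff F (1 + i) (h x) = g x.

(* M is isomorphic to the image of some differential of F. *)
Definition is_syzygy (F : complex) M : Prop :=
  exists (i : int) (j : {linear M -> F i}),
    injective j /\
    forall x, (exists m, j m = x) <-> (exists y, cdiff F i y = x).

Definition gorenstein_flat M : Prop :=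
  exists F : complex,
    [/\ acyclic F, forall i, flat_module (F i),
        forall I : lmodType R^c, injective_module I -> tensor_acyclic I F
      & is_syzygy F M].

Definition gorenstein_injective M : Prop :=
  exists I : complex,
    [/\ acyclic I, forall i, injective_module (I i),
        forall J : lmodType R, injective_module J -> hom_acyclic J I
      & is_syzygy I M].

End Homological.



Definition int_in_rat : pred rat := fun q => q \is a Num.int.

Lemma int_in_rat_closed : zmod_closed int_in_rat.
Proof.
by split=> [|p q]; rewrite !unfold_in; [apply: rpred0 | apply: rpredB].
Qed.

HB.instance Definition _ :=
  GRing.isZmodClosed.Build rat int_in_rat int_in_rat_closed.

Definition rat_mod_int : zmodType :=
  {ideal_quot (GRing.ZmodClosed.clone rat int_in_rat _)}.

Definition pontryagin_dual (R : pzRingType) (M : lmodType R) : Type :=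
  {additive M -> rat_mod_int}.

Section Dual.
Variables (R : pzRingType) (M : lmodType R).
Local Notation DM := (pontryagin_dual M).
Local Notation hom := {additive M -> rat_mod_int}.
Implicit Types f g : hom.

Lemma dualP (f g : DM) : (forall m, (f : hom) m = (g : hom) m) -> f = g.
Proof.
case: f g => [f [[cf]]] [g [[cg]]] /= /funext fg; subst g.
by rewrite (Prop_irrelevance cf cg).
Qed.

HB.instance Definition _ := gen_eqMixin DM.
HB.instance Definition _ := gen_choiceMixin DM.

Definition dual_zero : DM := (\0 : M -> rat_mod_int) : hom.
Definition dual_opp (f : DM) : DM := (\- (f : hom)) : hom.
Definition dual_add (f g : DM) : DM := ((f : hom) \+ (g : hom)) : hom.

Lemma dual_addA : associative dual_add.
Proof. by move=> f g h; apply: dualP => m; apply: addrA. Qed.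
Lemma dual_addC : commutative dual_add.
Proof. by move=> f g; apply: dualP => m; apply: addrC. Qed.
Lemma dual_add0 : left_id dual_zero dual_add.
Proof. by move=> f; apply: dualP => m; apply: add0r. Qed.
Lemma dual_addN : left_inverse dual_zero dual_opp dual_add.
Proof. by move=> f; apply: dualP => m; apply: addNr. Qed.

HB.instance Definition _ :=
  GRing.isZmodule.Build DM dual_addA dual_addC dual_add0 dual_addN.

(* The right action is (f.r) m = f (r m). *)
Definition dual_act (r : R) (f : hom) : M -> rat_mod_int := fun m => f (r *: m).

Lemma dual_actB r f : zmod_morphism (dual_act r f).
Proof. by move=> m n; rewrite /dual_act scalerBr raddfB. Qed.

HB.instance Definition _ r f :=
  GRing.isZmodMorphism.Build M rat_mod_int (dual_act r f) (dual_actB r f).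

Definition dual_scale (r : R^c) (f : DM) : DM := dual_act r f : hom.

Lemma dual_scaleA r s f : dual_scale r (dual_scale s f) = dual_scale (r * s) f.
Proof. by apply: dualP => m; rewrite /= /dual_act /= /dual_act scalerA. Qed.
Lemma dual_scale1 : left_id 1 dual_scale.
Proof. by move=> f; apply: dualP => m; rewrite /= /dual_act scale1r. Qed.
Lemma dual_scaleDr : right_distributive dual_scale +%R.
Proof. by move=> r f g; apply: dualP => m. Qed.
Lemma dual_scaleDl f : {morph dual_scale^~ f : r s / r + s}.
Proof.
by move=> r s; apply: dualP => m; rewrite /= /dual_act scalerDl raddfD.
Qed.

HB.instance Definition _ := GRing.Zmodule_isLmodule.Build R^c DM
  dual_scaleA dual_scale1 dual_scaleDr dual_scaleDl.

End Dual.

Definition weak_characteristic (k : comPzRingType) (G : groupType)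
    (A : lmodType (group_ring k G)) : Prop :=
  [/\ flat_module (base_module A),
      fd_finite A
    & exists iota : {linear trivial_module k G -> A},
        pure_mono (base_map iota)].

(* Main.v *)
From HB Require Import structures.
From mathcomp Require Import all_boot all_order all_algebra.
From mathcomp Require Import finmap generic_quotient ring_quotient.
From mathcomp Require Import boolp classical_sets.
From mathcomp.multinomials Require Import monalg.
Require Import Defs.
Set Implicit Arguments.
Unset Strict Implicit.
Unset Printing Implicit Defensive.
Import Order.TTheory GRing.Theory Num.Theory.
Local Open Scope quotient_scope.
Local Open Scope ring_scope.

(** Write R for the group ring kG.

    That the dual of a Gorenstein flat module is Gorenstein injective holds over
    every ring: the Pontryagin dual of a flat module is injective, and maps from
    J into the dual of F are the characters of the tensor product of J and F.

    For the converse, the essential fact is that every injective R-module, left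
    or right, has finite flat dimension.  If E is an injective left module and A
    is a weak characteristic module, then E embeds in the tensor product over k
    of E and A with diagonal action, because k embeds in A purely over k; the
    embedding splits, so it suffices to bound the flat dimension of that tensor
    product.  It is at most the sum of the flat dimension of E over k, which is
    finite because E is injective over k, and that of A over R ([diag_dim],
    [group_ring_left_dim]); the base case [diag_flat] rests on associativity,
    that is, X tensored over R with the diagonal product of W and P is the
    diagonal product of X and W tensored over R with P.  The antipode of R exchanges left and right modules ([tor_zero_swap]).

    Assume now that the dual of M is Gorenstein injective.  Then Ext from
    injectives into it vanishes, which by duality means that the higher Tor of
    injective right modules with M vanishes ([tor_of_gorenstein_injective]).
    Since injective left modules have bounded flat dimension, any module M
    embeds in a module L of finite flat dimension such that the quotient N has
    an infinite coresolution by flat modules ([approximation]).  Since an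
    injective right module J has finite flat dimension, its higher Tor with N
    vanishes, hence so does its higher Tor with L.  A module of finite flat
    dimension with this property is flat, because every right module embeds in
    an injective one ([tor_acyclic_flat]).  So M embeds in a flat module with a
    quotient that satisfies the same vanishing of Tor; free covers satisfy the
    analogous statement on the other side, and repeating both steps forever
    gives an acyclic complex of flat modules with M as a syzygy, which stays
    acyclic after tensoring with injectives ([gorenstein_flat_of_tor]).

    Tor and Ext enter only through the vanishing of a single group, expressed by
    dimension shifting; resolutions and modules are therefore produced by
    existence statements, one short exact sequence at a time. *)

(** * Linear maps, submodules and quotient modules *)

Lemma exists_lin (R : pzRingType) (A B : lmodType R) (f : A -> B) :
  linear f -> exists g : {linear A -> B}, forall x, g x = f x.
Proof.
move=> fL.
pose g : {linear A -> B} := HB.pack f (GRing.isLinear.Build R A B *:%R f fL).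
by exists g.
Qed.

Lemma exists_add (A B : zmodType) (f : A -> B) :
  zmod_morphism f -> exists g : {additive A -> B}, forall x, g x = f x.
Proof.
move=> fB.
pose g : {additive A -> B} := HB.pack f (GRing.isZmodMorphism.Build A B f fB).
by exists g.
Qed.

Section SubModule.
Variables (R : pzRingType) (N : lmodType R) (S : submodClosed N).
Definition submodule : Type := {x : N | x \in S}.
HB.instance Definition _ := SubChoice.on submodule.
HB.instance Definition _ := [SubChoice_isSubLmodule of submodule by <:].
End SubModule.

Section QuotientModule.
Variables (R : pzRingType) (N : lmodType R) (P : {pred N}) (HP : submod_closed P).
Lemma submodB : zmod_closed P.
Proof.
case: HP => P0 PL; split=> // x y xP yP; rewrite addrC -scaleN1r; exact: PL.
Qed.
Definition submodS : zmodClosed N :=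
  HB.pack P (GRing.isZmodClosed.Build N P submodB).
Definition quotient : Type := {ideal_quot submodS}.
HB.instance Definition _ := GRing.Zmodule.on quotient.
Definition proj (x : N) : quotient := \pi_({ideal_quot submodS}) x.

Lemma proj_eq x y : (proj x = proj y) <-> (x - y \in P).
Proof.
have -> : (x - y \in P) = (x - y \in submodS) by [].
by rewrite Quotient.idealrBE; split=> /eqP.
Qed.
Lemma proj_surj (q : quotient) : exists x, proj x = q.
Proof. by exists (repr q); rewrite /proj reprK. Qed.
Lemma projB : zmod_morphism proj.
Proof. by move=> x y; rewrite /proj raddfB. Qed.
Definition qscale r (q : quotient) : quotient := proj (r *: repr q).
Lemma qscaleE r x : qscale r (proj x) = proj (r *: x).
Proof.
apply/proj_eq; rewrite -scalerBr; case: HP => P0 PL.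
rewrite -[_ *: _]addr0; apply: PL => //; apply/proj_eq.
by rewrite [LHS]/proj reprK.
Qed.
Lemma qscaleA r s v : qscale r (qscale s v) = qscale (r * s) v.
Proof. by have [x <-] := proj_surj v; rewrite !qscaleE scalerA. Qed.
Lemma qscale1 : left_id 1 qscale.
Proof. by move=> v; have [x <-] := proj_surj v; rewrite !qscaleE scale1r. Qed.
HB.instance Definition _ := GRing.isZmodMorphism.Build N quotient proj projB.
Lemma qscaleDr : right_distributive qscale +%R.
Proof.
move=> r u v; have [x <-] := proj_surj u; have [y <-] := proj_surj v.
by rewrite -raddfD !qscaleE -raddfD scalerDr.
Qed.
Lemma qscaleDl v : {morph qscale^~ v : r s / r + s}.
Proof.
move=> r s; have [x <-] := proj_surj v.
by rewrite !qscaleE -raddfD scalerDl.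
Qed.
HB.instance Definition _ := GRing.Zmodule_isLmodule.Build R quotient
  qscaleA qscale1 qscaleDr qscaleDl.
Lemma projZ : scalable proj.
Proof. by move=> r x; rewrite -qscaleE. Qed.
HB.instance Definition _ := GRing.isScalable.Build R N quotient _ proj projZ.
End QuotientModule.

Section ShortExact.
Variable R : pzRingType.
Implicit Types A B C K N Q V : lmodType R.

Lemma inj_lin (A B : zmodType) (f : {additive A -> B}) :
  injective f <-> forall x, f x = 0 -> x = 0.
Proof.
split=> [fI x fx0|f0 x y /eqP]; first by apply: fI; rewrite raddf0.
by rewrite -subr_eq0 -raddfB => /eqP/f0/eqP; rewrite subr_eq0 => /eqP.
Qed.

Record ses A B C (f : {linear A -> B}) (g : {linear B -> C}) : Prop := Ses {
  ses_inj : injective f;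
  ses_surj : forall c, exists b, g b = c;
  ses_exact : exact_at f g }.

Lemma sesK A B C (f : {linear A -> B}) (g : {linear B -> C}) x :
  ses f g -> g (f x) = 0.
Proof. by case=> _ _ fg; apply/fg; exists x. Qed.

Lemma ex_sub N (P : N -> Prop) :
    P 0 -> (forall a x y, P x -> P y -> P (a *: x + y)) ->
  exists (K : lmodType R) (i : {linear K -> N}),
    injective i /\ forall x, P x <-> exists k, i k = x.
Proof.
move=> P0 PL; pose Pb : pred N := fun x => `[< P x >].
have H : submod_closed Pb.
  split=> [|a x y]; first exact/asboolP.
  by move=> /asboolP Px /asboolP Py; apply/asboolP/PL.
have HB := submodB H.
pose S : submodClosed N := HB.pack Pb (GRing.isSubmodClosed.Build R N Pb H).
exists (submodule S : lmodType R), (val : {linear submodule S -> N}).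
split=> [|x]; first exact: val_inj.
split=> [Px|[k <-]]; last by apply/asboolP/(valP k).
have xS : x \in S by apply/asboolP.
by exists (exist _ x xS).
Qed.

Lemma ex_quot N (P : N -> Prop) :
    P 0 -> (forall a x y, P x -> P y -> P (a *: x + y)) ->
  exists (Q : lmodType R) (q : {linear N -> Q}),
    (forall c, exists x, q x = c) /\ forall x, q x = 0 <-> P x.
Proof.
move=> P0 PL; pose Pb : pred N := fun x => `[< P x >].
have H : submod_closed Pb.
  split=> [|a x y]; first exact/asboolP.
  by move=> /asboolP Px /asboolP Py; apply/asboolP/PL.
exists (quotient H : lmodType R), (@proj _ _ _ H : {linear N -> quotient H}).
split=> [c|x]; first exact: proj_surj.
have -> : (0 = @proj _ _ _ H 0) by rewrite raddf0.
by rewrite proj_eq subr0; split=> /asboolP.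
Qed.

Lemma ex_kernel B C (g : {linear B -> C}) :
  exists (K : lmodType R) (i : {linear K -> B}), injective i /\ exact_at i g.
Proof.
apply: (@ex_sub B (fun x => g x = 0)) => [|a x y]; first exact: raddf0.
by rewrite linearP => -> ->; rewrite scaler0 addr0.
Qed.

Lemma ex_ker_ses B C (g : {linear B -> C}) : (forall c, exists b, g b = c) ->
  exists (K : lmodType R) (i : {linear K -> B}), ses i g.
Proof. by move=> gS; have [K [i [iI iE]]] := ex_kernel g; exists K, i. Qed.

Lemma ex_coker_ses A B (f : {linear A -> B}) : injective f ->
  exists (C : lmodType R) (g : {linear B -> C}), ses f g.
Proof.
move=> fI; have [||C [g [gS gE]]] := @ex_quot B (fun x => exists a, f a = x).
- by exists 0; rewrite raddf0.
- by move=> a _ _ [x <-] [y <-]; exists (a *: x + y); rewrite linearP.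
by exists C, g.
Qed.

Lemma lift_inj K N V (i : {linear K -> N}) (f : {linear V -> N}) :
    injective i -> (forall v, exists k, i k = f v) ->
  exists h : {linear V -> K}, forall v, i (h v) = f v.
Proof.
move=> iI H; pose h v := sval (cid (H v)).
have hE v : i (h v) = f v by rewrite /h; case: cid.
have [|g gE] := @exists_lin R V K h.
  by move=> a x y; apply: iI; rewrite linearP !hE linearP.
by exists g => v; rewrite gE.
Qed.

Lemma factor_surj N Q V (q : {linear N -> Q}) (f : {linear N -> V}) :
    (forall c, exists x, q x = c) -> (forall x, q x = 0 -> f x = 0) ->
  exists h : {linear Q -> V}, forall x, h (q x) = f x.
Proof.
move=> qS H; pose s c := sval (cid (qS c)).
have sE c : q (s c) = c by rewrite /s; case: cid.
have fE x y : q x = q y -> f x = f y.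
  move=> /eqP; rewrite -subr_eq0 -raddfB => /eqP/H/eqP.
  by rewrite raddfB subr_eq0 => /eqP.
have [|g gE] := @exists_lin R Q V (f \o s).
  by move=> a x y /=; rewrite -linearP; apply: fE; rewrite linearP !sE.
by exists g => x; rewrite gE /=; apply: fE; rewrite sE.
Qed.

End ShortExact.

(** * Tensor products *)

Section TensorBasics.
Variables (R : pzRingType).
Implicit Types (X : lmodType R^c) (N : lmodType R).

Lemma tensDl X N (x x' : X) (n : N) : tens (x + x') n = tens x n + tens x' n.
Proof. by have [h _ _] := @tens_balanced R X N. Qed.
Lemma tensDr X N (x : X) (n n' : N) : tens x (n + n') = tens x n + tens x n'.
Proof. by have [_ h _] := @tens_balanced R X N. Qed.
Lemma tensZ X N (x : X) (r : R^c) (n : N) :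
  tens (r *: x) n = tens x (@GRing.scale R N r n).
Proof. by have [_ _ h] := @tens_balanced R X N. Qed.

Lemma tensBl X N (n : N) : zmod_morphism (fun x : X => tens x n).
Proof. by move=> x y; apply/eqP; rewrite eq_sym subr_eq -tensDl subrK. Qed.
Lemma tensBr X N (x : X) : zmod_morphism (fun n : N => tens x n).
Proof. by move=> m n; apply/eqP; rewrite eq_sym subr_eq -tensDr subrK. Qed.

HB.instance Definition _ X N (x : X) := GRing.isZmodMorphism.Build
  N (tensor X N) (tens x) (tensBr x).

Definition tensr X N (n : N) (x : X) : tensor X N := tens x n.
HB.instance Definition _ X N (n : N) := GRing.isZmodMorphism.Build
  X (tensor X N) (tensr n) (tensBl n).

Lemma tens0l X N (n : N) : tens (0 : X) n = 0.
Proof. exact: (raddf0 (tensr n)). Qed.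
Lemma tens0r X N (x : X) : tens x (0 : N) = 0.
Proof. exact: (raddf0 (tens x)). Qed.

Lemma tensor_ind X N (P : tensor X N -> Prop) :
    P 0 -> (forall s t, P s -> P t -> P (s + t)) ->
    (forall x n, P (tens x n)) ->
  forall t, P t.
Proof.
move=> P0 PD PT t; rewrite -[t]reprK (monalgE (repr t)) raddf_sum.
apply: big_ind => // p _; set z := (repr t)@_p.
have -> : << z *g p >> = << p >> *~ z :> {malg int[(X * N)%type]}.
  by rewrite -(raddfMz (mkmalgU p)) intz.
rewrite raddfMz /=; case: p @z => x n z.
rewrite -[X in X *~ z]/(tens x n) -(raddfMz (tensr n)); exact: PT.
Qed.

Lemma tensor_hom_eq X N (V : zmodType) (f g : {additive tensor X N -> V}) :
  (forall x n, f (tens x n) = g (tens x n)) -> f =1 g.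
Proof.
by move=> fg; apply: tensor_ind => [|s t Hs Ht|//]; rewrite ?raddf0 // !raddfD Hs Ht.
Qed.

Lemma ex_tensor_lift X N (V : zmodType) (f : X -> N -> V) : balanced f ->
  exists h : {additive tensor X N -> V}, forall x n, h (tens x n) = f x n.
Proof.
move=> fb; have [h hE] := exists_add (tensor_liftB fb).
by exists h => x n; rewrite hE tensor_liftE.
Qed.

End TensorBasics.

Section TensorMap.
Variables (R : pzRingType) (X Y : lmodType R^c) (M N : lmodType R).
Variables (f : {linear X -> Y}) (g : {linear M -> N}).

HB.instance Definition _ := GRing.isZmodMorphism.Build
  (tensor X M) (tensor Y N) (tensor_map f g) (tensor_liftB (tensor_map_balanced f g)).

Lemma tensor_map_tens x m : tensor_map f g (tens x m) = tens (f x) (g m).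
Proof. exact: (tensor_liftE (tensor_map_balanced f g)). Qed.

Lemma tensor_map_inj :
  injective (tensor_map f g) <-> forall t, tensor_map f g t = 0 -> t = 0.
Proof. exact: inj_lin. Qed.

End TensorMap.

Local Notation lmap f N := (tensor_map f (idfun : {linear N -> N})).
Local Notation rmap X g := (tensor_map (idfun : {linear X -> X}) g).

Section TensorFunctor.
Variable R : pzRingType.
Implicit Types (X Y Z : lmodType R^c) (M N P : lmodType R).

Lemma tensor_map_sq X X1 X2 Y M M1 M2 N
    (f1 : {linear X -> X1}) (f1' : {linear X1 -> Y})
    (f2 : {linear X -> X2}) (f2' : {linear X2 -> Y})
    (g1 : {linear M -> M1}) (g1' : {linear M1 -> N})
    (g2 : {linear M -> M2}) (g2' : {linear M2 -> N}) :
    (forall x, f1' (f1 x) = f2' (f2 x)) -> (forall m, g1' (g1 m) = g2' (g2 m)) ->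
  forall t, tensor_map f1' g1' (tensor_map f1 g1 t)
          = tensor_map f2' g2' (tensor_map f2 g2 t).
Proof.
move=> Hf Hg; apply: (tensor_hom_eq
  (f := tensor_map f1' g1' \o tensor_map f1 g1)
  (g := tensor_map f2' g2' \o tensor_map f2 g2)) => x m /=.
by rewrite !tensor_map_tens Hf Hg.
Qed.

Lemma tensor_map_id X M t :
  tensor_map (idfun : {linear X -> X}) (idfun : {linear M -> M}) t = t.
Proof.
apply: (tensor_hom_eq (f := tensor_map _ _) (g := idfun)) => x m.
by rewrite /= tensor_map_tens.
Qed.

Lemma tensor_map_comp X X1 Y M M1 N
    (f1 : {linear X -> X1}) (f1' : {linear X1 -> Y}) (f : {linear X -> Y})
    (g1 : {linear M -> M1}) (g1' : {linear M1 -> N}) (g : {linear M -> N}) :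
    (forall x, f1' (f1 x) = f x) -> (forall m, g1' (g1 m) = g m) ->
  forall t, tensor_map f1' g1' (tensor_map f1 g1 t) = tensor_map f g t.
Proof.
by move=> Hf Hg t; rewrite -[in RHS](tensor_map_id t); apply: tensor_map_sq.
Qed.

Lemma lmap_rmap X Y M N (f : {linear X -> Y}) (g : {linear M -> N}) t :
  lmap f N (rmap X g t) = rmap Y g (lmap f M t).
Proof. exact: tensor_map_sq. Qed.

Lemma tensor_map_surj X Y M N (f : {linear X -> Y}) (g : {linear M -> N}) :
    (forall y, exists x, f x = y) -> (forall n, exists m, g m = n) ->
  forall t, exists s, tensor_map f g s = t.
Proof.
move=> fS gS; apply: tensor_ind => [|_ _ [s <-] [t <-]|y n].
- by exists 0; rewrite raddf0.
- by exists (s + t); rewrite raddfD.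
have [[x <-] [m <-]] := (fS y, gS n).
by exists (tens x m); rewrite /= tensor_map_tens.
Qed.

Lemma lmap_surj X Y N (f : {linear X -> Y}) :
  (forall y, exists x, f x = y) -> forall t, exists s, lmap f N s = t.
Proof. by move=> fS; apply: tensor_map_surj => // n; exists n. Qed.

Lemma rmap_surj X M N (g : {linear M -> N}) :
  (forall y, exists x, g x = y) -> forall t, exists s, rmap X g s = t.
Proof. by move=> fS; apply: tensor_map_surj => // n; exists n. Qed.

End TensorFunctor.

Lemma ex_zquot (T : zmodType) (P : T -> Prop) :
    P 0 -> (forall x y, P x -> P y -> P (x - y)) ->
  exists (Q : zmodType) (q : {additive T -> Q}), forall x, q x = 0 <-> P x.
Proof.
move=> P0 PB; pose Pb : pred T := fun x => `[< P x >].
have H : zmod_closed Pb.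
  split=> [|x y]; first exact/asboolP.
  by move=> /asboolP Px /asboolP Py; apply/asboolP/PB.
pose S : zmodClosed T := HB.pack Pb (GRing.isZmodClosed.Build T Pb H).
exists ({ideal_quot S} : zmodType), (\pi_({ideal_quot S}) : {additive _ -> _}) => x.
have -> : (\pi_({ideal_quot S}) x = 0) <-> (x - 0 \in S).
  by rewrite Quotient.idealrBE raddf0; split=> /eqP.
by rewrite subr0; split=> /asboolP.
Qed.

Lemma ex_zcoker (S T : zmodType) (f : {additive S -> T}) :
  exists (Q : zmodType) (q : {additive T -> Q}), exact_at f q.
Proof.
have [||Q [q qE]] := @ex_zquot T (fun x => exists a, f a = x).
- by exists 0; rewrite raddf0.
- by move=> _ _ [x <-] [y <-]; exists (x - y); rewrite raddfB.
by exists Q, q.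
Qed.

Section RightExact.
Variable R : pzRingType.

(** A section of [g] followed by the projection of the middle term onto the
    cokernel of [rmap X f] is balanced, since [g b] determines the class of
    [tens x b]; hence that projection factors through [rmap X g]. *)
Lemma rmap_exact (X : lmodType R^c) (A B C : lmodType R)
    (f : {linear A -> B}) (g : {linear B -> C}) :
  ses f g -> exact_at (rmap X f) (rmap X g).
Proof.
move=> [_ gS gE] t; split=> [gt0|[s <-]]; last first.
  rewrite (@tensor_map_comp _ _ _ _ _ _ _ _ _ idfun _ _ (\0 : {linear A -> C})) //.
    move: s; apply: (tensor_hom_eq (f := tensor_map _ _) (g := \0)) => x a /=.
    by rewrite tensor_map_tens /= tens0r.
  by move=> m /=; apply/gE; exists m.
have [Q [q qE]] := ex_zcoker (rmap X f); apply/qE.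
pose s c := sval (cid (gS c)).
have sE c : g (s c) = c by rewrite /s; case: cid.
pose h x c := q (tens x (s c)).
have qtE x b b' : g b = g b' -> q (tens x b) = q (tens x b').
  move=> /eqP; rewrite -subr_eq0 -raddfB => /eqP/gE[a fa].
  apply/eqP; rewrite -subr_eq0 -!raddfB -fa; apply/eqP/qE.
  by exists (tens x a); rewrite /= tensor_map_tens.
have hb : balanced h.
  rewrite /h; split=> [x x' c|x c c'|x r c].
  - by rewrite tensDl raddfD.
  - by rewrite -raddfD -tensDr; apply: qtE; rewrite sE raddfD /= !sE.
  - by rewrite tensZ; apply: qtE; rewrite sE linearZZ /= !sE.
have [k kE] := ex_tensor_lift hb.
suff -> : q t = k (rmap X g t) by rewrite gt0 raddf0.
move: t {gt0}; apply: (tensor_hom_eq (f := q) (g := k \o rmap X g)) => x b /=.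
by rewrite /= tensor_map_tens kE /h; apply: qtE; rewrite sE.
Qed.

Lemma lmap_exact (N : lmodType R) (A B C : lmodType R^c)
    (f : {linear A -> B}) (g : {linear B -> C}) :
  ses f g -> exact_at (lmap f N) (lmap g N).
Proof.
move=> [_ gS gE] t; split=> [gt0|[s <-]]; last first.
  rewrite (@tensor_map_comp _ _ _ _ _ _ _ _ _ (\0 : {linear A -> C}) _ _ idfun) //.
    move: s; apply: (tensor_hom_eq (f := tensor_map _ _) (g := \0)) => x a /=.
    by rewrite tensor_map_tens /= tens0l.
  by move=> m /=; apply/gE; exists m.
have [Q [q qE]] := ex_zcoker (lmap f N); apply/qE.
pose s c := sval (cid (gS c)).
have sE c : g (s c) = c by rewrite /s; case: cid.
pose h c n : Q := q (tens (s c) n).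
have qtE n b b' : g b = g b' -> q (tens b n) = q (tens b' n).
  move=> /eqP; rewrite -subr_eq0 -raddfB => /eqP/gE[a fa].
  apply/eqP; rewrite -subr_eq0 -raddfB -[_ - _](tensBl n) -fa; apply/eqP/qE.
  by exists (tens a n); rewrite /= tensor_map_tens.
have hb : balanced h.
  rewrite /h; split=> [c c' n|c n n'|c r n].
  - by rewrite -raddfD -tensDl; apply: qtE; rewrite sE raddfD /= !sE.
  - by rewrite tensDr raddfD.
  - by rewrite -tensZ; apply: qtE; rewrite sE linearZZ /= !sE.
have [k kE] := ex_tensor_lift hb.
suff -> : q t = k (lmap g N t) by rewrite gt0 raddf0.
move: t {gt0}; apply: (tensor_hom_eq (f := q) (g := k \o lmap g N)) => b n /=.
by rewrite /= tensor_map_tens kE /h; apply: qtE; rewrite sE.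
Qed.

End RightExact.

Section DualBasis.
Variables (R : pzRingType) (N : lmodType R).

Variables (I : choiceType) (e : I -> N) (c : I -> {linear N -> R^o}).

Definition expands (n : N) : Prop :=
  exists s : {fset I}, forall s' : {fset I}, (s `<=` s')%fset ->
    n = \sum_(i <- s') (c i n : R) *: e i.

Lemma expands0 : expands 0.
Proof. by exists fset0 => s _; rewrite big1 // => i _; rewrite raddf0 scale0r. Qed.

Lemma expandsD m n : expands m -> expands n -> expands (m + n).
Proof.
move=> [s Hs] [t Ht]; exists (s `|` t)%fset => u su.
rewrite {1}(Hs u) ?(fsubset_trans (fsubsetUl _ _) su) //.
rewrite {1}(Ht u) ?(fsubset_trans (fsubsetUr _ _) su) // -big_split /=.
by apply: eq_bigr => i _; rewrite raddfD scalerDl.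
Qed.

(** A dual basis (as for projective modules) recovers each element of a tensor
    product from its coordinates, so a map on the other factor that kills all
    coordinates only if they vanish is injective. *)
Lemma dual_basis_flat :
    (forall n, expands n) ->
  flat_module N.
Proof.
move=> cE.
have [cf cfE] : exists cf : forall (A : lmodType R^c), I -> {additive tensor A N -> A},
    forall A i a n, cf A i (tens a n) = ((c i n : R) : R^c) *: a.
  have H (A : lmodType R^c) (i : I) : exists cf : {additive tensor A N -> A},
      forall a n, cf (tens a n) = ((c i n : R) : R^c) *: a.
    apply: ex_tensor_lift; split=> [a a' n|a n n'|a r n].
    - exact: scalerDr.
    - by rewrite raddfD scalerDl.
    - by rewrite linearZZ scalerA.
  by exists (fun A i => sval (cid (H A i))) => A i; case: cid.
have tE (A : lmodType R^c) (t : tensor A N) : exists s : {fset I},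
    forall s' : {fset I}, (s `<=` s')%fset -> t = \sum_(i <- s') tens (cf A i t) (e i).
  move: t; apply: tensor_ind => [|t u [st Ht] [su Hu]|a n].
  - by exists fset0 => s' _; rewrite big1 // => i _; rewrite raddf0 tens0l.
  - exists (st `|` su)%fset => s' ss'.
    rewrite {1}(Ht s') ?(fsubset_trans (fsubsetUl _ _) ss') //.
    rewrite {1}(Hu s') ?(fsubset_trans (fsubsetUr _ _) ss') // -big_split /=.
    by apply: eq_bigr => i _; rewrite raddfD tensDl.
  - have [s Hs] := cE n; exists s => s' /Hs {1}->; rewrite raddf_sum.
    by apply: eq_bigr => i _; rewrite cfE tensZ.
move=> A B f fI; apply/inj_lin => t ft0; have [s Hs] := tE A t.
rewrite (Hs s) // big1 // => i _.
suff -> : cf A i t = 0 by rewrite tens0l.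
apply: fI; rewrite raddf0.
suff -> : f (cf A i t) = cf B i (lmap f N t) by rewrite ft0 raddf0.
move: t {ft0 s Hs}.
apply: (tensor_hom_eq (f := f \o cf A i) (g := cf B i \o lmap f N)) => a n /=.
by rewrite tensor_map_tens !cfE linearZZ.
Qed.

End DualBasis.

(** * Free modules and pullbacks *)

Lemma malg_ind (K : choiceType) (A : zmodType) (P : {malg A[K]} -> Prop) :
    P 0 -> (forall x y, P x -> P y -> P (x + y)) ->
    (forall c k, P << c *g k >>) -> forall x, P x.
Proof. by move=> P0 PD PU x; rewrite (monalgE x); apply: big_ind. Qed.

Lemma ex_msum (K : choiceType) (A V : zmodType) (F : K -> A -> V) :
    (forall k, zmod_morphism (F k)) ->
  exists h : {additive {malg A[K]} -> V}, forall a k, h << a *g k >> = F k a.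
Proof.
move=> FB; have [h hE] := exists_add (malg_sumB FB).
by exists h => a k; rewrite hE malg_sumU.
Qed.

Definition free_carrier (R : pzRingType) (X : choiceType) : Type := {malg R[X]}.

Section FreeScaling.
Variables (R : pzRingType) (X : choiceType).
Local Notation F := (free_carrier R X).
HB.instance Definition _ := GRing.Zmodule.on F.

Definition free_scale (r : R) (g : F) : F :=
  \sum_(x <- msupp g) << r * g@_x *g x >>.

Lemma free_scale_coef r (g : F) x : (free_scale r g)@_x = r * g@_x.
Proof.
rewrite raddf_sum /= [in RHS](monalgE g) raddf_sum mulr_sumr.
by apply: eq_bigr => y _; rewrite /= !mcoeffU mulrnAr.
Qed.

Lemma free_scaleA r s v : free_scale r (free_scale s v) = free_scale (r * s) v.
Proof. by apply/malgP => x; rewrite !free_scale_coef mulrA. Qed.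
Lemma free_scale1 : left_id 1 free_scale.
Proof. by move=> v; apply/malgP => x; rewrite free_scale_coef mul1r. Qed.
Lemma free_scaleDr : right_distributive free_scale +%R.
Proof.
by move=> r u v; apply/malgP => x; rewrite !(free_scale_coef, mcoeffD) mulrDr.
Qed.
Lemma free_scaleDl v : {morph free_scale^~ v : r s / r + s}.
Proof.
by move=> r s; apply/malgP => x; rewrite !(free_scale_coef, mcoeffD) mulrDl.
Qed.
HB.instance Definition _ := GRing.Zmodule_isLmodule.Build R F
  free_scaleA free_scale1 free_scaleDr free_scaleDl.
End FreeScaling.

Definition free_module (R : pzRingType) (X : choiceType) : lmodType R :=
  free_carrier R X.

Section FreeModule.
Variables (R : pzRingType) (X : choiceType).
Local Notation F := (free_module R X).

Definition free_gen (r : R) (x : X) : F := << r *g x >>.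
Definition free_coef (x : X) (g : F) : R := (g : {malg R[X]})@_x.

Lemma free_coefD x u v : free_coef x (u + v) = free_coef x u + free_coef x v.
Proof. exact: mcoeffD. Qed.

Lemma free_coefZ r x g : free_coef x (r *: g) = r * free_coef x g.
Proof. exact: free_scale_coef. Qed.

Lemma free_coefU x y r : free_coef y (free_gen r x) = r *+ (x == y).
Proof. exact: mcoeffU. Qed.

Lemma free_genZ r s x : r *: free_gen s x = free_gen (r * s) x.
Proof.
apply/malgP => y; rewrite -[LHS]/(free_coef y (r *: free_gen s x)) free_coefZ.
by rewrite /free_coef /free_gen !mcoeffU mulrnAr.
Qed.

Lemma free_genD r s x : free_gen (r + s) x = free_gen r x + free_gen s x.
Proof. exact: monalgUD. Qed.
Lemma free_gen0 x : free_gen 0 x = 0.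
Proof. exact: monalgU0. Qed.

Lemma free_ind (P : F -> Prop) :
    P 0 -> (forall x y, P x -> P y -> P (x + y)) ->
    (forall r x, P (free_gen r x)) -> forall g, P g.
Proof. exact: malg_ind. Qed.

Lemma free_univ (N : lmodType R) (phi : X -> N) :
  exists h : {linear F -> N}, forall r x, h (free_gen r x) = r *: phi x.
Proof.
have [h hE] : exists h : {additive F -> N}, forall r x, h (free_gen r x) = r *: phi x.
  by apply: (@ex_msum X R N (fun x r => r *: phi x)) => x r s; rewrite scalerBl.
have [|l lE] := @exists_lin R F N h.
  move=> r u v; rewrite raddfD; congr (_ + _); elim/free_ind: u => [|u w Hu Hw|c x].
  - by rewrite scaler0 raddf0 scaler0.
  - by rewrite scalerDr !raddfD /= Hu Hw.
  - by rewrite free_genZ !hE scalerA.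
by exists l => r x; rewrite lE hE.
Qed.

Lemma free_hom_eq (N : lmodType R) (f g : {linear F -> N}) :
  (forall x, f (free_gen 1 x) = g (free_gen 1 x)) -> f =1 g.
Proof.
move=> fg; elim/free_ind => [|u v Hu Hv|r x]; first by rewrite !raddf0.
  by rewrite !raddfD /= Hu Hv.
by rewrite -[r]mulr1 -free_genZ !linearZZ fg.
Qed.

Lemma free_coef_linear x : exists c : {linear F -> R^o}, forall g, c g = free_coef x g.
Proof.
by apply: exists_lin => a u v; rewrite free_coefD free_coefZ.
Qed.

Lemma free_sumE (g : F) (s : {fset X}) : (msupp (g : {malg R[X]}) `<=` s)%fset ->
  g = \sum_(x <- s) free_coef x g *: free_gen 1 x.
Proof.
move=> gs; rewrite {1}[g](monalgEw gs); apply: eq_bigr => x _.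
by rewrite free_genZ mulr1.
Qed.

Lemma free_flat : flat_module F.
Proof.
apply: (@dual_basis_flat R F X (free_gen 1)
          (fun x => sval (cid (free_coef_linear x)))) => g.
exists (msupp (g : {malg R[X]})) => s /free_sumE {1}->; apply: eq_bigr => x _.
by case: cid => c /= ->.
Qed.

Lemma free_projective (B C : lmodType R) (q : {linear B -> C}) (f : {linear F -> C}) :
    (forall c, exists b, q b = c) ->
  exists h : {linear F -> B}, forall x, q (h x) = f x.
Proof.
move=> qS; pose phi x := sval (cid (qS (f (free_gen 1 x)))).
have phiE x : q (phi x) = f (free_gen 1 x) by rewrite /phi; case: cid.
have [h hE] := free_univ phi; exists h.
by apply: (free_hom_eq (f := q \o h)) => x /=; rewrite hE scale1r phiE.
Qed.

End FreeModule.

Lemma free_cover (R : pzRingType) (N : lmodType R) :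
  exists e : {linear free_module R N -> N}, forall n, exists x, e x = n.
Proof.
have [h hE] := @free_univ R N N id; exists h => n.
by exists (free_gen 1 n); rewrite hE scale1r.
Qed.

Lemma free_ses (R : pzRingType) (N : lmodType R) :
  exists (K : lmodType R) (i : {linear K -> free_module R N})
    (e : {linear free_module R N -> N}), ses i e.
Proof.
have [e eS] := free_cover N; have [K [i ie]] := ex_ker_ses eS.
by exists K, i, e.
Qed.

Record pullback_of (R : pzRingType) (A B C P : lmodType R) (f : {linear A -> C})
    (g : {linear B -> C}) (p : {linear P -> A}) (q : {linear P -> B}) : Prop := Pullback {
  pb_comm : forall t, f (p t) = g (q t);
  pb_ex : forall a b, f a = g b -> exists t, p t = a /\ q t = b;
  pb_inj : forall t, p t = 0 -> q t = 0 -> t = 0 }.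

Lemma ex_pullback (R : pzRingType) (A B C : lmodType R) (f : {linear A -> C})
    (g : {linear B -> C}) :
  exists (P : lmodType R) (p : {linear P -> A}) (q : {linear P -> B}),
    pullback_of f g p q.
Proof.
have [||P [i [iI iE]]] := @ex_sub R (A * B)%type (fun x => f x.1 = g x.2).
- by rewrite /= !raddf0.
- by move=> a x y /= Hx Hy; rewrite !linearP Hx Hy.
have [|p pE] := @exists_lin R P A (fun t => (i t).1).
  by move=> a x y; rewrite linearP.
have [|q qE] := @exists_lin R P B (fun t => (i t).2).
  by move=> a x y; rewrite linearP.
exists P, p, q; split=> [t|a b ab|t].
- by rewrite pE qE; apply/iE; exists t.
- by have /iE[t it] : f (a, b).1 = g (a, b).2 by []; exists t; rewrite pE qE it.
rewrite pE qE => p0 q0; apply: iI; rewrite raddf0.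
by rewrite (surjective_pairing (i t)) p0 q0.
Qed.

(** * The group Q/Z *)

Local Notation QZ := rat_mod_int.

Section RatModInt.

Definition qz_pi : {additive rat -> QZ} :=
  \pi_({ideal_quot (GRing.ZmodClosed.clone rat int_in_rat _)}).

Lemma qz_pi_eq0 q : qz_pi q = 0 <-> q \is a Num.int.
Proof.
have -> : (qz_pi q = 0) <-> (qz_pi q = qz_pi 0) by rewrite raddf0.
rewrite -[q \is a _]/(q \in GRing.ZmodClosed.clone rat int_in_rat _) -{2}[q]subr0.
by rewrite Quotient.idealrBE; split=> /eqP.
Qed.

Lemma qz_piS (y : QZ) : exists q, qz_pi q = y.
Proof. by exists (repr y); rewrite /qz_pi /= reprK. Qed.

Lemma qz_div (d : nat) (y : QZ) : (0 < d)%N -> exists z, z *+ d = y.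
Proof.
move=> d_gt0; have [q <-] := qz_piS y; exists (qz_pi (q / d%:R)).
have qd : q / d%:R *+ d = q by rewrite -mulr_natr divfK // pnatr_eq0 -lt0n.
by rewrite -raddfMn -[q in RHS]qd.
Qed.

Lemma qz_torsion (d : nat) : (1 < d)%N -> exists2 y : QZ, y != 0 & y *+ d = 0.
Proof.
move=> d_gt1; have d_gt0 : (0 : rat) < d%:R by rewrite ltr0n (ltn_trans _ d_gt1).
exists (qz_pi (d%:R)^-1).
  apply/negP => /eqP/qz_pi_eq0/intrP[m mE].
  have m_gt0 : (0 < m)%R by rewrite -(ltr0z rat) -mE invr_gt0.
  have : (1 : rat) <= m%:~R by rewrite ler1z -gtz0_ge1.
  by rewrite -mE invf_ge1 // lern1 leqNgt d_gt1.
have d1 : (d%:R)^-1 *+ d = 1 :> rat.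
  by rewrite -(mulr_natr (d%:R)^-1) mulVf // gt_eqF.
by rewrite -raddfMn; apply/qz_pi_eq0; rewrite [X in X \is a _]d1; apply: rpred1.
Qed.

End RatModInt.

Section Extension.
Variable T : zmodType.

(** Homomorphisms from a subgroup of [T] to Q/Z, given by their graphs, so that
    the union of a chain needs no construction. *)
Definition graph_sub (G : T -> QZ -> Prop) : Prop :=
  [/\ G 0 0, forall x y x' y', G x y -> G x' y' -> G (x - x') (y - y')
    & forall y, G 0 y -> y = 0].

Lemma graph_mulz G (x : T) (y : QZ) (n : int) :
  graph_sub G -> G x y -> G (x *~ n) (y *~ n).
Proof.
move=> [G0 GB _] Gxy.
have GN a b : G a b -> G (- a) (- b) by move=> /(GB _ _ _ _ G0); rewrite !sub0r.
have Gn (m : nat) : G (x *+ m) (y *+ m).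
  elim: m => [//|m /GN IH]; rewrite !mulrS -[x *+ m]opprK -[y *+ m]opprK.
  exact: GB.
by case: n => m; rewrite ?NegzE ?mulrNz; last apply: GN; apply: Gn.
Qed.

Lemma graph_fun G x y y' : graph_sub G -> G x y -> G x y' -> y = y'.
Proof.
move=> [G0 GB GF] Gy Gy'; apply/eqP; rewrite -subr_eq0; apply/eqP/GF.
by rewrite -(subrr x); apply: GB.
Qed.

(** If [d] is the least positive integer such that [x *+ d] lies in the domain,
    with value [b], then any [y] with [y *+ d = b] is a value for [x], and one
    exists by divisibility; if no positive multiple of [x] lies in the domain,
    then every [y] is. *)
Lemma graph_extend G (x : T) : graph_sub G ->
  exists G', [/\ graph_sub G', forall u v, G u v -> G' u v & exists y, G' x y].
Proof.
move=> Gs; have [G0 GB GF] := Gs.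
have [y yE] : exists y : QZ, forall (n : int) b, G (x *~ n) b -> b = y *~ n.
  have [y yE] : exists y : QZ, forall (n : nat) b, G (x *+ n) b -> b = y *+ n.
    have [ex|nex] := pselect (exists d, (0 < d)%N /\ exists b, G (x *+ d) b).
      have ex' : exists d, (0 < d)%N && `[< exists b, G (x *+ d) b >].
        by case: ex => d [d0 Hd]; exists d; rewrite d0; apply/asboolP.
      case: (ex_minnP ex') => d /andP[d_gt0 /asboolP[b Gdb]] dmin.
      have [y yd] := qz_div b d_gt0; exists y => n c Gnc.
      have Gq := graph_mulz (n %/ d)%N Gs Gdb.
      have nE : n = (n %/ d * d + n %% d)%N := divn_eq n d.
      have Gr : G (x *+ (n %% d)) (c - b *+ (n %/ d)).
        have := GB _ _ _ _ Gnc Gq; congr (G _ _).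
        by rewrite -[_ *~ _]/(_ *+ _) {1}nE mulrnDr mulrnA mulrnAC addrC addKr.
      have r0 : (n %% d = 0)%N.
        apply/eqP; rewrite -leqn0 leqNgt; apply/negP => r_gt0.
        have : (d <= n %% d)%N.
          by apply: dmin; rewrite r_gt0; apply/asboolP; exists (c - b *+ (n %/ d)).
        by rewrite leqNgt ltn_pmod.
      move: Gr; rewrite r0 => /GF/eqP; rewrite subr_eq0 => /eqP->.
      by rewrite nE r0 addn0 mulnK // mulnC mulrnA yd.
    exists 0 => n b; case: n => [|n] Gb; first by rewrite mulr0n; apply: GF.
    by case: nex; exists n.+1; split=> //; exists b.
  exists y => -[n|n] b; first exact: yE.
  rewrite NegzE !mulrNz => Gb; apply: oppr_inj; rewrite opprK; apply: yE.
  by rewrite -[_ *+ _]opprK -sub0r -[- b]sub0r; apply: GB.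
exists (fun u v => exists a b (n : int), [/\ G a b, u = a + x *~ n & v = b + y *~ n]).
split; last first.
- by exists y, 0, 0, 1; split=> //; rewrite add0r.
- by move=> u v Guv; exists u, v, 0; rewrite !mulr0z !addr0.
split; first by exists 0, 0, 0; rewrite !mulr0z !addr0.
  move=> _ _ _ _ [a [b [n [Gab -> ->]]]] [a' [b' [n' [Gab' -> ->]]]].
  exists (a - a'), (b - b'), (n - n'); split; first exact: GB.
    by rewrite mulrzBr opprD addrACA.
  by rewrite mulrzBr opprD addrACA.
move=> v [a [b [n [Gab /eqP]]]]; rewrite eq_sym addr_eq0 => /eqP aE ->.
move: Gab; rewrite aE -mulrNz => /yE ->; rewrite mulrNz; exact: addNr.
Qed.

(** By Zorn's lemma there is a maximal extension, and its domain is everything by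
    [graph_extend]: this is the injectivity of Q/Z as an abelian group. *)
Lemma graph_hom G : graph_sub G ->
  exists h : {additive T -> QZ}, forall x y, G x y -> h x = y.
Proof.
move=> Gs.
pose P := {H : T -> QZ -> Prop | graph_sub H /\ forall x y, G x y -> H x y}.
pose le (H K : P) := `[< forall x y, sval H x y -> sval K x y >].
have [||||[H [Hs GH]] Hmax] := @Zorn P le.
- by move=> H; apply/asboolP.
- by move=> H K L /asboolP HK /asboolP KL; apply/asboolP => x y /HK/KL.
- move=> [H pH] [K pK] /asboolP /= HK /asboolP /= KH.
  apply: eq_exist; apply/funext => x; apply/funext => y; apply/propext; split; [exact: HK|exact: KH].
- move=> C Ctot.
  pose U x y := G x y \/ exists2 H : P, C H & sval H x y.
  have [G0 GB GF] := Gs.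
  have Us : graph_sub U.
    split; first by left.
    - move=> x y x' y' [Gxy|[H CH Hxy]] [Gxy'|[K CK Kxy]].
      + by left; apply: GB.
      + by right; exists K => //; case: K {CK} Kxy => K [[K0 KB KF] GK] /= Kxy; apply: KB => //; apply: GK.
      + by right; exists H => //; case: H {CH} Hxy => H [[H0 HB HF] GH] /= Hxy; apply: HB => //; apply: GH.
      + have [/asboolP HK|/asboolP KH] := Ctot _ _ CH CK; right.
          by exists K => //; case: K {CK Kxy HK} (HK _ _ Hxy) Kxy => K [[K0 KB KF] GK] /= *; apply: KB.
        by exists H => //; case: H {CH Hxy KH} (KH _ _ Kxy) Hxy => H [[H0 HB HF] GH] /= *; apply: HB.
    - by move=> y [/GF//|[[H [[H0 HB HF] GH]] _ /= /HF]].
  have pU : graph_sub U /\ forall x y, G x y -> U x y by split=> // x y; left.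
  by exists (exist _ U pU) => H CH; apply/asboolP => x y Hxy; right; exists H.
have Htot x : exists y, H x y.
  have [H' [Hs' HH' [y H'xy]]] := graph_extend x Hs.
  have pH' : graph_sub H' /\ forall x y, G x y -> H' x y by split=> // u v /GH/HH'.
  have /(congr1 sval) /= <- : exist _ H' pH' = exist _ H (conj Hs GH) :> P.
    by apply: Hmax; apply/asboolP.
  by exists y.
pose h x := sval (cid (Htot x)).
have hE x : H x (h x) by rewrite /h; case: cid.
have [|k kE] := @exists_add T QZ h.
  have [_ HB _] := Hs; move=> x y.
  by apply: (graph_fun Hs (hE (x - y))); apply: HB.
by exists k => x y /GH Hxy; rewrite kE; apply: graph_fun Hs (hE x) Hxy.
Qed.

End Extension.

Lemma qz_extend (S T : zmodType) (i : {additive S -> T}) (f : {additive S -> QZ}) :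
  injective i -> exists h : {additive T -> QZ}, forall x, h (i x) = f x.
Proof.
move=> iI; have [|h hE] := @graph_hom T (fun x y => exists2 s, i s = x & f s = y).
  split=> [|x y x' y' [s <- <-] [s' <- <-]|y [s]].
  - by exists 0; rewrite raddf0.
  - by exists (s - s'); rewrite raddfB.
  - by rewrite -{1}(raddf0 i) => /iI -> <-; rewrite raddf0.
by exists h => x; apply: hE; exists x.
Qed.

(** A nonzero [y] whose order divides that of [t] defines a homomorphism on the
    cyclic group generated by [t], and this extends. *)
Lemma qz_separate (T : zmodType) (t : T) :
  (forall h : {additive T -> QZ}, h t = 0) -> t = 0.
Proof.
move=> ht; apply/eqP; apply/negP => /negP t0.
have [y y0 yE] : exists2 y : QZ, y != 0 & forall n : int, t *~ n = 0 -> y *~ n = 0.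
  have [ex|nex] := pselect (exists d, (0 < d)%N && (t *+ d == 0)).
    case: (ex_minnP ex) => d /andP[d_gt0 /eqP td] dmin.
    have d_gt1 : (1 < d)%N.
      rewrite ltn_neqAle d_gt0 andbT eq_sym; apply: contraNneq t0 => d1.
      by rewrite -[t]mulr1n -d1 td.
    have [y y0 yd] := qz_torsion d_gt1; exists y => // n.
    suff H (m : nat) : t *+ m = 0 -> y *+ m = 0.
      case: n => n; first exact: H.
      by rewrite NegzE !mulrNz => /eqP; rewrite oppr_eq0 => /eqP tn; rewrite [y *~ _](H n.+1 tn) oppr0.
    rewrite (divn_eq m d) !mulrnDr mulnC !mulrnA td yd !mul0rn !add0r => r0.
    have [->//|r_gt0] := posnP (m %% d)%N.
    have : (d <= m %% d)%N by apply: dmin; rewrite r_gt0 r0 eqxx.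
    by rewrite leqNgt ltn_pmod.
  have [y y0 _] := @qz_torsion 2 isT; exists y => // -[[|n]|n] tn //.
    by case: nex; exists n.+1; apply/eqP.
  by case: nex; exists n.+1; move: tn; rewrite NegzE mulrNz => /eqP; rewrite oppr_eq0.
have [|h hE] := @graph_hom T (fun u v => exists2 n : int, u = t *~ n & v = y *~ n).
  split=> [|_ _ _ _ [n -> ->] [m -> ->]|v [n /esym/yE]].
  - by exists 0.
  - by exists (n - m); rewrite mulrzBr.
  - by move=> -> ->.
by move: y0; rewrite -(hE t y) ?ht ?eqxx //; exists 1.
Qed.

(** * Pontryagin duals *)

Section DualEval.
Variables (R : pzRingType).
Implicit Types (M N P : lmodType R) (X Y : lmodType R^c).
Local Notation D N := (pontryagin_dual N : lmodType R^c).

Definition ev M (f : D M) (m : M) : QZ := (f : {additive M -> QZ}) m.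

Lemma evDl M (f g : D M) m : ev (f + g) m = ev f m + ev g m.
Proof. by []. Qed.
Lemma ev0l M m : ev (0 : D M) m = 0.
Proof. by []. Qed.
Lemma evDr M (f : D M) m n : ev f (m + n) = ev f m + ev f n.
Proof. exact: (raddfD (f : {additive M -> QZ})). Qed.
Lemma evB M (f : D M) m n : ev f (m - n) = ev f m - ev f n.
Proof. exact: (raddfB (f : {additive M -> QZ})). Qed.
Lemma ev0r M (f : D M) : ev f 0 = 0.
Proof. exact: (raddf0 (f : {additive M -> QZ})). Qed.
Lemma evZ M (f : D M) (r : R^c) m : ev (r *: f) m = ev f (@GRing.scale R M r m).
Proof. by []. Qed.

Lemma ev_eq M (f g : D M) : (forall m, ev f m = ev g m) -> f = g.
Proof. exact: dualP. Qed.

Lemma ex_dual M (chi : {additive M -> QZ}) : exists f : D M, forall m, ev f m = chi m.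
Proof. by exists chi. Qed.

Lemma ex_dual_lin X M (F : X -> M -> QZ) : balanced F ->
  exists phi : {linear X -> D M}, forall x m, ev (phi x) m = F x m.
Proof.
move=> [FD FDr FZ].
have H x : exists f : D M, forall m, ev f m = F x m.
  have [|chi chiE] := @exists_add M QZ (F x).
    by move=> m n; apply/eqP; rewrite eq_sym subr_eq -FDr subrK.
  by have [f fE] := ex_dual chi; exists f => m; rewrite fE.
pose h x := sval (cid (H x)); have hE x m : ev (h x) m = F x m by rewrite /h; case: cid.
have [|phi phiE] := @exists_lin R^c X (D M) h.
  by move=> r x y; apply: ev_eq => m; rewrite evDl evZ !hE FD FZ.
by exists phi => x m; rewrite phiE hE.
Qed.

Lemma ex_dual_map M N (g : {linear M -> N}) :
  exists g' : {linear D N -> D M}, forall f m, ev (g' f) m = ev f (g m).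
Proof.
apply: (@ex_dual_lin (D N) M (fun f m => ev f (g m))); split=> [f f' m|f m m'|f r m].
- exact: evDl.
- by rewrite raddfD evDr.
- by rewrite evZ linearZZ.
Qed.

Definition dual_map M N (g : {linear M -> N}) : {linear D N -> D M} :=
  sval (cid (ex_dual_map g)).

Lemma dual_mapE M N (g : {linear M -> N}) f m : ev (dual_map g f) m = ev f (g m).
Proof. by rewrite /dual_map; case: cid. Qed.

Lemma ev_balanced X N (phi : {linear X -> D N}) : balanced (fun x n => ev (phi x) n).
Proof.
split=> [x y n|x m n|x r n]; first by rewrite raddfD evDl.
  exact: evDr.
by rewrite linearZZ evZ.
Qed.

(** With [hom_of_char], the adjunction between tensor products and linear maps. *)
Lemma char_of_hom X N (phi : {linear X -> D N}) :
  exists chi : {additive tensor X N -> QZ}, forall x n, chi (tens x n) = ev (phi x) n.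
Proof. exact: ex_tensor_lift (ev_balanced phi). Qed.

Lemma hom_of_char X N (chi : {additive tensor X N -> QZ}) :
  exists phi : {linear X -> D N}, forall x n, ev (phi x) n = chi (tens x n).
Proof.
apply: (@ex_dual_lin X N (fun x n => chi (tens x n))); split=> [x y n|x m n|x r n].
- by rewrite tensDl raddfD.
- by rewrite tensDr raddfD.
- by rewrite tensZ.
Qed.

(** By [char_of_hom] this is the extension of a character along an injection. *)
Lemma dual_extends X Y N (i : {linear X -> Y}) (phi : {linear X -> D N}) :
    injective (lmap i N) ->
  exists psi : {linear Y -> D N}, forall x, psi (i x) = phi x.
Proof.
move=> iI; have [chi chiE] := char_of_hom phi.
have [chi' chi'E] := qz_extend chi iI; have [psi psiE] := hom_of_char chi'.
exists psi => x; apply: ev_eq => n; rewrite psiE -chiE -chi'E.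
by rewrite /= tensor_map_tens.
Qed.

(** Characters separate the points of the tensor product of [X] and [N]. *)
Lemma dual_extends_inv X Y N (i : {linear X -> Y}) :
    (forall phi : {linear X -> D N},
       exists psi : {linear Y -> D N}, forall x, psi (i x) = phi x) ->
  injective (lmap i N).
Proof.
move=> H; apply/inj_lin => t t0; apply: qz_separate => chi.
have [phi phiE] := hom_of_char chi; have [psi psiE] := H phi.
have [chi' chi'E] := char_of_hom psi.
suff -> : chi t = chi' (lmap i N t) by rewrite t0 raddf0.
move: t {t0}; apply: (tensor_hom_eq (f := chi) (g := chi' \o lmap i N)) => x n /=.
by rewrite tensor_map_tens chi'E psiE phiE.
Qed.

Lemma dual_injective N : flat_module N -> injective_module (D N).
Proof. by move=> Nf A B i g /Nf iI; apply: dual_extends. Qed.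

Lemma dual_lifts X M N (i : {linear M -> N}) (phi : {linear X -> D M}) :
    injective (rmap X i) ->
  exists psi : {linear X -> D N}, forall x, dual_map i (psi x) = phi x.
Proof.
move=> iI; have [chi chiE] := char_of_hom phi.
have [chi' chi'E] := qz_extend chi iI; have [psi psiE] := hom_of_char chi'.
exists psi => x; apply: ev_eq => n; rewrite dual_mapE psiE -chiE -chi'E.
by rewrite /= tensor_map_tens.
Qed.

Lemma dual_ses M N P (f : {linear M -> N}) (g : {linear N -> P}) :
  ses f g -> ses (dual_map g) (dual_map f).
Proof.
move=> [fI gS fg]; split=> [|phi|psi].
- apply/inj_lin => phi phi0; apply: ev_eq => p; have [n <-] := gS p.
  by rewrite -dual_mapE phi0.
- have [chi chiE] := qz_extend (phi : {additive M -> QZ}) fI.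
  have [psi psiE] := ex_dual chi; exists psi; apply: ev_eq => m.
  by rewrite dual_mapE psiE chiE.
split=> [psi0|[phi <-]]; last first.
  apply: ev_eq => m; rewrite !dual_mapE ev0l.
  by have /fg -> : exists m', f m' = f m by [exists m]; rewrite ev0r.
pose s p := sval (cid (gS p)); have sE p : g (s p) = p by rewrite /s; case: cid.
have H n n' : g n = g n' -> ev psi n = ev psi n'.
  move=> /eqP; rewrite -subr_eq0 -raddfB => /eqP/fg[m mE].
  by apply/eqP; rewrite -subr_eq0 -evB -mE -dual_mapE psi0.
have [|chi chiE] := @exists_add P QZ (fun p => ev psi (s p)).
  by move=> p q /=; rewrite -evB; apply: H; rewrite raddfB /= !sE.
have [phi phiE] := ex_dual chi; exists phi; apply: ev_eq => n.
by rewrite dual_mapE phiE chiE; apply: H; rewrite sE.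
Qed.

End DualEval.

(** * Change of sides *)

Definition restr_lin (R S : pzRingType) (phi : {rmorphism R -> S})
    (V W : lmodType S) (f : {linear V -> W}) :
  {linear restr phi V -> restr phi W} := restr_map phi f.

Section Swap.
Variables (R S : pzRingType).
Variables (tau : {rmorphism S -> R^c}) (tau' : {rmorphism S^c -> R}).
Hypothesis tauE : forall s, tau s = tau' s.
Hypothesis tau_surj : forall r : R, exists s, tau' s = r.

(** Through an anti-isomorphism every right module becomes a left one and vice
    versa, and the two factors of a tensor product change places.  This is used
    for the identity of [R^c], which compares flatness over [R] with flatness
    over [R^c], and for the antipode of a group ring. *)
Lemma ex_swap (G : lmodType R^c) (A : lmodType R) :
  exists h : {additive tensor G A -> tensor (restr tau' A) (restr tau G)},
    (forall g a, h (tens g a) = tens (a : restr tau' A) (g : restr tau G)) /\ injective h.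
Proof.
have [|h hE] := @ex_tensor_lift R G A (tensor (restr tau' A) (restr tau G))
  (fun g a => tens (a : restr tau' A) (g : restr tau G)).
  split=> [g g' a|g a a'|g r a]; first exact: tensDr.
    exact: tensDl.
  have [s <-] := tau_surj r.
  rewrite -[RHS](esym (@tensZ S (restr tau' A) (restr tau G) a s g)).
  by congr tens; rewrite -[RHS]/(tau s *: (g : G)) tauE.
exists h; split=> //.
have [|k kE] := @ex_tensor_lift S (restr tau' A) (restr tau G) (tensor G A)
  (fun a g => tens (g : G) (a : A)).
  split=> [a a' g|a g g'|a s g]; first exact: tensDr.
    exact: tensDl.
  transitivity (tens (g : G) (@GRing.scale R A (tau' s) a)); first by [].
  rewrite -[LHS](@tensZ R G A g (tau' s) a).
  by congr tens; rewrite -[RHS]/(tau s *: (g : G)) tauE.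
apply: (can_inj (g := k)).
by apply: (tensor_hom_eq (f := k \o h) (g := idfun)) => g a /=; rewrite hE kE.
Qed.

Lemma swap_rmap_inj (G : lmodType R^c) (A B : lmodType R) (f : {linear A -> B}) :
  injective (lmap (restr_lin tau' f) (restr tau G)) -> injective (rmap G f).
Proof.
move=> fI; have [hA [hAE hAI]] := ex_swap G A; have [hB [hBE hBI]] := ex_swap G B.
have E t : hB (rmap G f t) = lmap (restr_lin tau' f) (restr tau G) (hA t).
  move: t; apply: (tensor_hom_eq (f := hB \o rmap G f)
    (g := lmap (restr_lin tau' f) (restr tau G) \o hA)) => g a /=.
  by rewrite tensor_map_tens hBE hAE tensor_map_tens.
by move=> s t st; apply/hAI/fI; rewrite -!E st.
Qed.

End Swap.

Section FlatRight.
Variable R : pzRingType.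

Definition flat_right (G : lmodType R^c) : Prop :=
  forall (A B : lmodType R) (f : {linear A -> B}),
    injective f -> injective (rmap G f).

Lemma flat_retract (N N' : lmodType R) (p : {linear N -> N'}) (q : {linear N' -> N}) :
  (forall n, q (p n) = n) -> flat_module N' -> flat_module N.
Proof.
move=> qp N'f A B f /N'f fI s t st; rewrite -[s]tensor_map_id -[t]tensor_map_id.
have pI : injective (rmap A p).
  apply: (can_inj (g := rmap A q)) => u.
  by rewrite (tensor_map_comp (f := idfun) (g := idfun)) ?tensor_map_id.
by rewrite !tensor_map_id; apply/pI/fI; rewrite !lmap_rmap st.
Qed.

End FlatRight.

(** [R^c^c] has the operations of [R] but is a different ring structure. *)
Definition of_conv_conv_fun (R : pzRingType) (r : R^c^c) : R := r.
Definition to_conv_conv_fun (R : pzRingType) (r : R) : R^c^c := r.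

Section ConvConv.
Variable R : pzRingType.

Lemma of_conv_convB : zmod_morphism (@of_conv_conv_fun R). Proof. by []. Qed.
Lemma of_conv_convM : monoid_morphism (@of_conv_conv_fun R). Proof. by []. Qed.
Lemma to_conv_convB : zmod_morphism (@to_conv_conv_fun R). Proof. by []. Qed.
Lemma to_conv_convM : monoid_morphism (@to_conv_conv_fun R). Proof. by []. Qed.

Definition of_conv_conv : {rmorphism R^c^c -> R} := HB.pack (@of_conv_conv_fun R)
  (GRing.isZmodMorphism.Build _ _ _ of_conv_convB)
  (GRing.isMonoidMorphism.Build _ _ _ of_conv_convM).
Definition to_conv_conv : {rmorphism R -> R^c^c} := HB.pack (@to_conv_conv_fun R)
  (GRing.isZmodMorphism.Build _ _ _ to_conv_convB)
  (GRing.isMonoidMorphism.Build _ _ _ to_conv_convM).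

End ConvConv.

Lemma free_flat_right (R : pzRingType) X : flat_right (free_module R^c X).
Proof.
pose G := free_module R^c X.
have Gf : flat_module (restr (idfun : {rmorphism R^c -> R^c}) G).
  have [|p pE] := @exists_lin _ (restr (idfun : {rmorphism R^c -> R^c}) G) G id; first by [].
  have [|q qE] := @exists_lin _ G (restr (idfun : {rmorphism R^c -> R^c}) G) id; first by [].
  by apply: (@flat_retract _ _ G p q) => [n|]; [rewrite qE pE|apply: free_flat].
move=> A B f fI; apply: (@swap_rmap_inj R R^c idfun (of_conv_conv R)) => //.
  by move=> r; exists r.
exact: Gf.
Qed.

(** * Vanishing of Tor *)

Section TorVanishing.
Variable R : pzRingType.
Implicit Types (X Y G B : lmodType R^c) (M N H : lmodType R).

(** Two presentations make a grid of tensor products; an element killed by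
    [lmap f N] is lifted to [tensor X' H] and chased to [tensor X N'], where
    injectivity of [rmap X a] kills it. *)
Lemma snake_l X' B X N' H N (f : {linear X' -> B}) (g : {linear B -> X})
    (a : {linear N' -> H}) (b : {linear H -> N}) :
    ses f g -> ses a b -> flat_module H -> injective (rmap X a) ->
  injective (lmap f N).
Proof.
move=> fg ab Hf /tensor_map_inj aI; apply/tensor_map_inj => x x0.
have [y yx] := rmap_surj (ses_surj ab) x.
have [z zy] : exists z, rmap B a z = lmap f H y.
  by apply/(rmap_exact ab); rewrite -lmap_rmap yx.
have [w wz] : exists w, lmap f N' w = z.
  apply/(lmap_exact fg)/aI; rewrite -lmap_rmap zy.
  by apply/(lmap_exact fg); exists y.
rewrite -yx; apply/(rmap_exact ab); exists w.
by apply: (Hf _ _ _ (ses_inj fg)); rewrite -zy -wz lmap_rmap.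
Qed.

(** The same chase with the roles of the two presentations exchanged. *)
Lemma snake_r X' G X N' H N (f : {linear X' -> G}) (g : {linear G -> X})
    (a : {linear N' -> H}) (b : {linear H -> N}) :
    ses f g -> ses a b -> flat_right G -> injective (lmap f N) ->
  injective (rmap X a).
Proof.
move=> fg ab Gf /tensor_map_inj fI; apply/tensor_map_inj => x x0.
have [y yx] := lmap_surj (ses_surj fg) x.
have [z zy] : exists z, lmap f H z = rmap G a y.
  by apply/(lmap_exact fg); rewrite lmap_rmap yx.
have [w wz] : exists w, rmap X' a w = z.
  apply/(rmap_exact ab)/fI; rewrite lmap_rmap zy.
  by apply/(rmap_exact ab); exists y.
rewrite -yx; apply/(lmap_exact fg); exists w.
by apply: (Gf _ _ _ (ses_inj ab)); rewrite -zy -wz lmap_rmap.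
Qed.

(** The vanishing of the single group Tor_(i+1)(X, N), by dimension shifting
    along all presentations of X by flat modules; [tor_shift_l] shows that one
    presentation suffices. *)
Fixpoint tor_zero (i : nat) X N : Prop :=
  forall X' G (f : {linear X' -> G}) (g : {linear G -> X}),
    flat_right G -> ses f g ->
  match i with
  | 0 => injective (lmap f N)
  | j.+1 => tor_zero j X' N
  end.

Lemma tor0_of_l X' G X N (f : {linear X' -> G}) (g : {linear G -> X}) :
  ses f g -> flat_right G -> injective (lmap f N) -> tor_zero 0 X N.
Proof.
move=> fg Gf fI X1 G1 f1 g1 G1f fg1; have [K [a [b ab]]] := free_ses N.
apply: (snake_l fg1 ab) (@free_flat _ _) _.
exact: (snake_r fg ab).
Qed.

Lemma tor0_of_r X N' H N (a : {linear N' -> H}) (b : {linear H -> N}) :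
  ses a b -> flat_module H -> injective (rmap X a) -> tor_zero 0 X N.
Proof. by move=> ab Hf aI X1 G1 f1 g1 G1f fg1; apply: (snake_l fg1 ab). Qed.

Lemma tor0_rmap X N' H N (a : {linear N' -> H}) (b : {linear H -> N}) :
  ses a b -> tor_zero 0 X N -> injective (rmap X a).
Proof.
move=> ab T; have [K [f [g fg]]] := free_ses X.
exact: (snake_r fg ab) (@free_flat_right _ _) (T _ _ _ _ (@free_flat_right _ _) fg).
Qed.

(** Both sides say that the map from [tensor X' N'] to [tensor G H] is injective. *)
Lemma tor0_shift X' G X N' H N (f : {linear X' -> G}) (g : {linear G -> X})
    (a : {linear N' -> H}) (b : {linear H -> N}) :
    ses f g -> ses a b -> flat_right G -> flat_module H ->
  tor_zero 0 X N' <-> tor_zero 0 X' N.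
Proof.
move=> fg ab Gf Hf; have aI := Gf _ _ _ (ses_inj ab); have fI := Hf _ _ _ (ses_inj fg).
split=> [/(_ _ _ _ _ Gf fg)|/(tor0_rmap ab)] I.
  apply: (tor0_of_r ab Hf) => s t st; apply: I; apply: aI.
  by rewrite -!lmap_rmap st.
apply: (tor0_of_l fg Gf) => s t st; apply: I; apply: fI.
by rewrite !lmap_rmap st.
Qed.

(** The choice of presentation is immaterial: moving the shift to the other
    variable by one presentation of [N] and back compares any two presentations
    of [X]. *)
Lemma tor_balance i X' G X N' H N (f : {linear X' -> G}) (g : {linear G -> X})
    (a : {linear N' -> H}) (b : {linear H -> N}) :
    ses f g -> ses a b -> flat_right G -> flat_module H ->
  tor_zero i X N' <-> tor_zero i X' N.
Proof.
elim: i => [|i IH] in X' G X N' H N f g a b *; first exact: tor0_shift.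
move=> fg ab Gf Hf; split=> T X1 G1 f1 g1 G1f fg1.
  by apply/(IH _ _ _ _ _ _ _ _ _ _ fg1 ab G1f Hf); apply: T fg.
have [X2 [f2 [g2 fg2]]] := free_ses X'; have Ff2 := @free_flat_right R X'.
have /(IH _ _ _ _ _ _ _ _ _ _ fg2 ab Ff2 Hf) T' := T _ _ _ _ Ff2 fg2.
have [K [c [d cd]]] := free_ses N'.
apply/(IH _ _ _ _ _ _ _ _ _ _ fg1 cd G1f (@free_flat _ _)).
exact/(IH _ _ _ _ _ _ _ _ _ _ fg cd Gf (@free_flat _ _)).
Qed.

Lemma tor_shift_l i X' G X N (f : {linear X' -> G}) (g : {linear G -> X}) :
  ses f g -> flat_right G -> tor_zero i.+1 X N <-> tor_zero i X' N.
Proof.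
move=> fg Gf; split=> [T|T X1 G1 f1 g1 G1f fg1]; first exact: T Gf fg.
have [K [c [d cd]]] := free_ses N; have Ff := @free_flat R N.
apply/(tor_balance _ fg1 cd) => //; exact/(tor_balance _ fg cd).
Qed.

Lemma tor_shift_r i X N' H N (a : {linear N' -> H}) (b : {linear H -> N}) :
  ses a b -> flat_module H -> tor_zero i.+1 X N <-> tor_zero i X N'.
Proof.
move=> ab Hf; have [K [f [g fg]]] := free_ses X; have Ff := @free_flat_right R X.
by apply: iff_trans (tor_shift_l _ _ fg Ff) _; apply: iff_sym; apply: tor_balance fg ab Ff Hf.
Qed.

Lemma tor_zero_ext i X N' N N'' (a : {linear N' -> N}) (b : {linear N -> N''}) :
  ses a b -> tor_zero i X N' -> tor_zero i X N'' -> tor_zero i X N.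
Proof.
move=> ab; elim: i => [|i IH] in X *; last first.
  by move=> T1 T2 X1 G1 f1 g1 G1f fg1; apply: IH; [apply: T1 fg1|apply: T2 fg1].
move=> T1 T2 X1 G f g Gf fg; apply/tensor_map_inj => x x0.
have /tensor_map_inj I1 := T1 _ _ _ _ Gf fg; have /tensor_map_inj I2 := T2 _ _ _ _ Gf fg.
have [y yx] : exists y, rmap X1 a y = x.
  by apply/(rmap_exact ab)/I2; rewrite lmap_rmap x0 raddf0.
rewrite -yx (I1 y) ?raddf0 //; apply: (Gf _ _ _ (ses_inj ab)).
by rewrite -lmap_rmap yx x0 raddf0.
Qed.

(** The part of the long exact sequence of Tor that bounds the flat dimension
    of a cokernel. *)
Lemma tor_zero_coker i X N' M N (a : {linear N' -> M}) (b : {linear M -> N}) :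
  ses a b -> tor_zero i X N' -> tor_zero i.+1 X M -> tor_zero i.+1 X N.
Proof.
move=> ab; elim: i => [|i IH] in X *; last first.
  by move=> T1 T2 X1 G1 f1 g1 G1f fg1; apply: IH; [apply: T1 fg1|apply: T2 fg1].
move=> T1 T2 X1 G0 f0 g0 G0f fg0; have [X2 [f1 [g1 fg1]]] := free_ses X1.
have G1f := @free_flat_right R X1; apply: (tor0_of_l fg1 G1f).
have /tensor_map_inj I0 := T1 _ _ _ _ G0f fg0.
have I1 := T2 _ _ _ _ G0f fg0 _ _ _ _ G1f fg1.
apply/tensor_map_inj => x x0.
have [y yx] := rmap_surj (ses_surj ab) x.
have [z zy] : exists z, rmap (free_module R^c X1) a z = lmap f1 M y.
  by apply/(rmap_exact ab); rewrite -lmap_rmap yx.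
have [w wz] : exists w, lmap f1 N' w = z.
  apply/(lmap_exact fg1)/I0/(G0f _ _ _ (ses_inj ab)).
  rewrite -lmap_rmap -lmap_rmap zy raddf0.
  rewrite (_ : lmap g1 M _ = 0) ?raddf0 //.
  by apply/(lmap_exact fg1); exists y.
rewrite -yx; apply/(rmap_exact ab); exists w.
by apply: I1; rewrite -zy -wz lmap_rmap.
Qed.

Lemma tor_zero_retract i X N M (p : {linear N -> M}) (q : {linear M -> N}) :
  (forall n, q (p n) = n) -> tor_zero i X M -> tor_zero i X N.
Proof.
move=> qp; elim: i => [|i IH] in X *; last first.
  by move=> T X1 G f g Gf fg; apply: IH; apply: T fg.
move=> T X1 G f g Gf fg s t st.
have pI : injective (rmap X1 p).
  apply: (can_inj (g := rmap X1 q)) => u.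
  by rewrite (tensor_map_comp (f := idfun) (g := idfun)) ?tensor_map_id.
by apply/pI/(T _ _ _ _ Gf fg); rewrite !lmap_rmap st.
Qed.

Lemma tor_zero_flat i X N : flat_module N -> tor_zero i X N.
Proof.
move=> Nf; elim: i => [|i IH] in X *; last by move=> X1 G f g Gf fg; apply: IH.
by move=> X1 G f g Gf fg; apply: Nf (ses_inj fg).
Qed.

(** Flat dimension at most n, in terms of Tor; for [n = 0] this is flatness
    ([tor_dim0]). *)
Definition tor_dim_le (n : nat) N : Prop := forall X, tor_zero n X N.

Lemma tor_dim0 N : tor_dim_le 0 N -> flat_module N.
Proof.
move=> T A B f fI; have [C [g fg]] := ex_coker_ses fI.
have [K [a [b ab]]] := free_ses N.
exact: (snake_l fg ab) (@free_flat _ _) (tor0_rmap ab (T C)).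
Qed.

Lemma tor_dimS n N : tor_dim_le n N -> tor_dim_le n.+1 N.
Proof. by move=> T X X1 G f g Gf fg; apply: T. Qed.

Lemma tor_dim_leq m n N : (m <= n)%N -> tor_dim_le m N -> tor_dim_le n N.
Proof.
move=> mn T; have [k ->] : exists k, n = (m + k)%N by exists (n - m)%N; rewrite subnKC.
elim: k => [|k IH]; first by rewrite addn0.
by rewrite addnS; apply: tor_dimS.
Qed.

Lemma tor_dim_shift n N' H N (a : {linear N' -> H}) (b : {linear H -> N}) :
  ses a b -> flat_module H -> tor_dim_le n.+1 N <-> tor_dim_le n N'.
Proof. by move=> ab Hf; split=> T X; apply/(tor_shift_r n X ab Hf); apply: T. Qed.

Lemma fd_tor_dim n N : fd_le N n -> tor_dim_le n N.
Proof.
elim: n => [|n IH] in N * => -[F [d [e [Ff F0 eS de dd]]]].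
  have eI : injective e.
    by apply/inj_lin => x /de[y <-]; have -> : y = 0 by [apply: (F0 1%N)]; rewrite raddf0.
  have [|e' e'E] := @lift_inj R (F 0%N) N N e idfun eI; first exact: eS.
  move=> X; apply: (tor_zero_retract (p := e') (q := e)) => //.
  exact: tor_zero_flat.
have [K [i ie]] := ex_ker_ses eS.
have [|e' e'E] := @lift_inj R K (F 0%N) (F 1%N) i (d 0%N) (ses_inj ie).
  by move=> v; apply/(ses_exact ie)/de; exists v.
apply/(tor_dim_shift _ ie (Ff 0%N)); apply: IH.
exists (fun j => F j.+1), (fun j => d j.+1), e'; split=> //.
- by move=> j nj; apply: F0.
- move=> k; have /de[x xE] : e (i k) = 0 by apply/(ses_exact ie); exists k.
  by exists x; apply: (ses_inj ie); rewrite e'E.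
- move=> x; rewrite -(dd 0%N x) -e'E; split=> [->|]; first by rewrite raddf0.
  by move=> ix0; apply: (ses_inj ie); rewrite ix0 raddf0.
Qed.

End TorVanishing.

(** * Gorenstein injective duals *)

Section ExtVanishing.
Variable R : pzRingType.
Implicit Types (S Y E J Z : lmodType R).

(** The vanishing of Ext^(i+1)(S, Y), by dimension shifting along free
    presentations of S. *)
Fixpoint ext_zero (i : nat) S Y : Prop :=
  forall S' (X : choiceType) (f : {linear S' -> free_module R X})
    (g : {linear free_module R X -> S}), ses f g ->
  match i with
  | 0 => forall phi : {linear S' -> Y},
           exists psi : {linear free_module R X -> Y}, forall s, psi (f s) = phi s
  | j.+1 => ext_zero j S' Y
  end.

Definition lifts_along J E Z (b : {linear E -> Z}) : Prop :=
  forall phi : {linear J -> Z}, exists psi : {linear J -> E}, forall x, b (psi x) = phi x.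

(** Extend [phi] to a map into the injective [E]; it induces a map from [S] to
    [Z], and subtracting a lift of that map brings the values back into [Y]. *)
Lemma ext0_of_lifts S Y E Z (a : {linear Y -> E}) (b : {linear E -> Z}) :
  ses a b -> injective_module E -> lifts_along S b -> ext_zero 0 S Y.
Proof.
move=> ab Ei bS S' X f g fg phi.
have [psi psiE] := Ei _ _ f (a \o phi) (ses_inj fg).
have [|bar barE] := @factor_surj R _ _ _ g (b \o psi) (ses_surj fg).
  by move=> x /(ses_exact fg)[s <-] /=; rewrite psiE /= (sesK _ ab).
have [theta thetaE] := bS bar.
have [|h hE] := @lift_inj R Y E _ a (psi \- (theta \o g)) (ses_inj ab).
  move=> x; apply/(ses_exact ab); rewrite /= raddfB /= thetaE barE; exact: subrr.
exists h => s; apply: (ses_inj ab).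
by rewrite hE /= (sesK _ fg) raddf0 subr0 psiE.
Qed.

Lemma ext_shift i S Y E Z (a : {linear Y -> E}) (b : {linear E -> Z}) :
  ses a b -> injective_module E -> ext_zero i S Z -> ext_zero i.+1 S Y.
Proof.
move=> ab Ei; elim: i => [|i IH] in S *; last first.
  by move=> T S1 X f g fg; apply: IH; apply: T fg.
move=> T S1 X f g fg; apply: (ext0_of_lifts ab Ei) => phi.
have [psi psiE] := T _ _ _ _ fg phi.
have [psi' psi'E] := free_projective psi (ses_surj ab).
by exists (psi' \o f) => x /=; rewrite psi'E psiE.
Qed.

Lemma ext_zero_coresolution (C : lmodType R -> Prop) J :
    (forall Y, C Y -> exists E Z (a : {linear Y -> E}) (b : {linear E -> Z}),
       [/\ ses a b, injective_module E, lifts_along J b & C Z]) ->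
  forall i Y, C Y -> ext_zero i J Y.
Proof.
move=> HC; elim=> [|i IH] Y /HC [E [Z [a [b [ab Ei bJ CZ]]]]].
  exact: ext0_of_lifts ab Ei bJ.
exact: ext_shift ab Ei (IH _ CZ).
Qed.

End ExtVanishing.

Section Syzygies.
Variable R : pzRingType.

Lemma int_succ (i : int) : exists j : int, i = 1 + j.
Proof. by exists (i - 1); rewrite addrC subrK. Qed.

Lemma syzygy_right (F : complex R) (Z : lmodType R) :
    acyclic F -> is_syzygy F Z ->
  exists (j : int) (Z' : lmodType R) (a : {linear Z -> F (1 + j)})
         (b : {linear F (1 + j) -> Z'}) (c : {linear Z' -> F j}),
    [/\ ses a b, is_syzygy F Z', injective c &
        forall x, c (b x) = cdiff F j x].
Proof.
move=> Fa [i [a [aI aE]]]; have [j ij] := int_succ i; subst i.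
have [||Z' [c [cI cE]]] := @ex_sub R (F j) (fun x => exists y, cdiff F j y = x).
- by exists 0; rewrite raddf0.
- by move=> r _ _ [x <-] [y <-]; exists (r *: x + y); rewrite linearP.
have [|b bE] := @lift_inj R Z' (F j) (F (1 + j)) c (cdiff F j) cI.
  by move=> v; apply/cE; exists v.
exists j, Z', a, b, c; split=> //.
- split=> // [z|x].
    have /cE[y yE] : exists k, c k = c z by exists z.
    by exists y; apply: cI; rewrite bE.
  split=> [bx0|/aE/Fa]; first by apply/aE/Fa; rewrite -bE bx0 raddf0.
  by rewrite -bE => cbx0; apply: cI; rewrite cbx0 raddf0.
- by exists j, c; split=> // x; split=> /cE.
Qed.

Lemma syzygy_left (F : complex R) (Z : lmodType R) :
    acyclic F -> is_syzygy F Z ->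
  exists (j : int) (Z' : lmodType R) (a : {linear Z' -> F (1 + j)})
         (b : {linear F (1 + j) -> Z}) (c : {linear Z -> F j}),
    [/\ ses a b, is_syzygy F Z', injective c &
        forall x, c (b x) = cdiff F j x].
Proof.
move=> Fa [j [c [cI cE]]].
have [|b bE] := @lift_inj R Z (F j) (F (1 + j)) c (cdiff F j) cI.
  by move=> v; apply/cE; exists v.
have [Z' [a [aI aE]]] := ex_kernel (cdiff F j).
exists j, Z', a, b, c; split=> //.
- split=> // [z|x].
    have /cE[y yE] : exists k, c k = c z by exists z.
    by exists y; apply: cI; rewrite bE.
  split=> [bx0|/aE]; first by apply/aE; rewrite -bE bx0 raddf0.
  by rewrite -bE => cbx0; apply: cI; rewrite cbx0 raddf0.
- by exists (1 + j), a; split=> // x; split=> [/aE/Fa|/Fa/aE].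
Qed.

End Syzygies.

Section DualTor.
Variable R : pzRingType.

(** Ext into a Pontryagin dual is the dual of Tor. *)
Lemma tor_of_ext i (S : lmodType R^c) (M : lmodType R) :
  ext_zero i S (pontryagin_dual M : lmodType R^c) -> tor_zero i S M.
Proof.
elim: i => [|i IH] in S *; have [K [f [g fg]]] := free_ses S => T;
  have Ff := @free_flat_right R S.
  by apply: (tor0_of_l fg Ff); apply: dual_extends_inv => phi; apply: T fg phi.
by apply/(tor_shift_l _ _ fg Ff)/IH; apply: T fg.
Qed.

(** The syzygies to the right of the dual of [M] form a coresolution along which
    maps from injectives lift, so all higher Ext from injectives vanish. *)
Lemma tor_of_gorenstein_injective (M : lmodType R) (J : lmodType R^c) i :
    gorenstein_injective (pontryagin_dual M : lmodType R^c) ->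
    injective_module J ->
  tor_zero i J M.
Proof.
move=> [F [Fa Fi FJ FM]] Ji; apply: tor_of_ext.
apply: (@ext_zero_coresolution R^c (is_syzygy F)) (FM) => Y FY.
have [j [Z [a [b [c [ab FZ cI cb]]]]]] := syzygy_right Fa FY.
exists (F (1 + j)), Z, a, b; split=> // phi.
have [k jk] := int_succ j; subst j.
have [] := FJ J Ji k (c \o phi).
case=> [x|psi psiE _]; last first.
  by exists psi => x; apply: cI; rewrite cb psiE.
by rewrite /=; have [y <-] := ses_surj ab (phi x); rewrite cb cdiffK.
Qed.

End DualTor.

(** * Enough injective modules *)

Section EnoughInjectives.
Variable R : pzRingType.

(** [N] embeds in its double dual, hence in the dual of a free module covering the
    dual of [N]. *)
Lemma ex_dual_free (N : lmodType R) :
  exists (X : choiceType) (h : N -> pontryagin_dual (free_module R^c X)),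
    [/\ forall n n', h (n + n') = h n + h n',
        forall (r : R) n, h (r *: n) = (r : R^c^c) *: h n & injective h].
Proof.
pose DN : lmodType R^c := pontryagin_dual N; have [e eS] := free_cover DN.
have H (n : N) : exists f : pontryagin_dual (free_module R^c DN),
    forall x, ev f x = ev (e x) n.
  have [|chi chiE] := @exists_add (free_module R^c DN) QZ (fun x => ev (e x) n).
    by move=> x y; rewrite raddfB.
  by have [f fE] := ex_dual chi; exists f => x; rewrite fE.
pose h n := sval (cid (H n)); have hE n x : ev (h n) x = ev (e x) n by rewrite /h; case: cid.
exists DN, h; split=> [n n'|r n|n n' nn'].
- by apply: ev_eq => x; rewrite evDl !hE evDr.
- by apply: ev_eq => x; rewrite evZ !hE linearZZ evZ.
apply/eqP; rewrite -subr_eq0; apply/eqP/qz_separate => chi.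
have [f fE] := ex_dual chi; have [x xE] := eS f.
by rewrite -fE -xE evB -!hE nn' subrr.
Qed.

Lemma enough_injectives (N : lmodType R) :
  exists (E : lmodType R) (i : {linear N -> E}), injective_module E /\ injective i.
Proof.
have [X [h [hD hZ hI]]] := ex_dual_free N.
pose phi := to_conv_conv R; pose psi := of_conv_conv R.
pose D : lmodType R^c^c := pontryagin_dual (free_module R^c X).
have Di : injective_module D by apply/dual_injective/free_flat.
have [|i iE] := @exists_lin R N (restr phi D) h.
  by move=> r x y; rewrite hD hZ.
exists (restr phi D), i; split; last by move=> x y; rewrite !iE => /hI.
move=> A B j g jI.
have [|g' g'E] := @exists_lin R^c^c (restr psi A) D g.
  by move=> r x y; apply: (linearP g).
have [k kE] := Di (restr psi A) (restr psi B) (restr_lin psi j) g' jI.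
have [|k' k'E] := @exists_lin R B (restr phi D) k.
  by move=> r x y; apply: (linearP k).
by exists k' => a; rewrite k'E; apply: etrans (kE a) _; rewrite g'E.
Qed.

End EnoughInjectives.

(** * Splicing short exact sequences into complexes *)

Section Splicing.
Variable R : pzRingType.
Implicit Types (M U V F : lmodType R).
Variable good : forall U F V, {linear U -> F} -> {linear F -> V} -> Prop.

Definition link U V : Prop :=
  exists F (a : {linear U -> F}) (b : {linear F -> V}), ses a b /\ good a b.

(** The cycles are indexed so that [Z i] has its left neighbour at [1 + i]:
    nonnegative indices iterate the choice of a left neighbour, starting at [M],
    and negative ones iterate the choice of a right neighbour. *)
Lemma ex_splicing (C : lmodType R -> Prop) M :
    (forall Z, C Z -> exists2 Z', C Z' & link Z' Z) ->
    (forall Z, C Z -> exists2 Z', C Z' & link Z Z') ->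
    C M ->
  exists (Z F : int -> lmodType R) (a : forall i, {linear Z (1 + i) -> F i})
         (b : forall i, {linear F i -> Z i}),
    [/\ Z 0 = M, forall i, ses (a i) (b i) & forall i, good (a i) (b i)].
Proof.
move=> Cl Cr CM; pose T := {Z | C Z}.
have [l lE] : exists l : T -> T, forall Z, link (sval (l Z)) (sval Z).
  have H (Z : T) : exists Z' : T, link (sval Z') (sval Z).
    by case: Z => Z /= /Cl[Z' CZ' ?]; exists (exist _ Z' CZ').
  by exists (fun Z => sval (cid (H Z))) => Z; case: cid.
have [r rE] : exists r : T -> T, forall Z, link (sval Z) (sval (r Z)).
  have H (Z : T) : exists Z' : T, link (sval Z) (sval Z').
    by case: Z => Z /= /Cr[Z' CZ' ?]; exists (exist _ Z' CZ').
  by exists (fun Z => sval (cid (H Z))) => Z; case: cid.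
pose M0 : T := exist _ M CM.
pose Z (i : int) : lmodType R :=
  match i with Posz n => sval (iter n l M0) | Negz n => sval (iter n.+1 r M0) end.
have Zlink i : link (Z (1 + i)) (Z i).
  case: i => [n|[|n]]; [exact: lE|exact: rE|].
  have -> : 1 + Negz n.+1 = Negz n.
    by rewrite !NegzE -[n.+2]addn1 PoszD opprD addrCA subrr addr0.
  exact: rE.
pose F i := sval (cid (Zlink i)).
have aP i : exists (a : {linear Z (1 + i) -> F i}) (b : {linear F i -> Z i}),
    ses a b /\ good a b by rewrite /F; case: cid.
pose a i := sval (cid (aP i)).
have bP i : exists (b : {linear F i -> Z i}), ses (a i) b /\ good (a i) b.
  by rewrite /a; case: cid.
pose b i := sval (cid (bP i)).
have abP i : ses (a i) (b i) /\ good (a i) (b i) by rewrite /b; case: cid.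
by exists Z, F, a, b; split=> // i; case: (abP i).
Qed.

Section Spliced.
Variables (Z F : int -> lmodType R) (a : forall i, {linear Z (1 + i) -> F i})
  (b : forall i, {linear F i -> Z i}).
Hypothesis ab : forall i, ses (a i) (b i).

Definition spliced_diff i : {linear F (1 + i) -> F i} := a i \o b (1 + i).

Lemma spliced_diffK i x : spliced_diff i (spliced_diff (1 + i) x) = 0.
Proof. by rewrite /spliced_diff /= (sesK _ (ab (1 + i))) raddf0. Qed.

Definition spliced : complex R := Complex spliced_diffK.

Lemma spliced_acyclic : acyclic spliced.
Proof.
move=> i x; rewrite /= /spliced_diff /=; split=> [x0|[y <-]]; last first.
  by rewrite (sesK _ (ab (1 + i))) raddf0.
have /(ses_exact (ab (1 + i)))[z <-] : b (1 + i) x = 0.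
  by apply: (ses_inj (ab i)); rewrite x0 raddf0.
by have [y <-] := ses_surj (ab (1 + (1 + i))) z; exists y.
Qed.

Lemma spliced_syzygy : is_syzygy spliced (Z 0).
Proof.
exists (-1), (a (-1)); split=> [|x]; first exact: ses_inj (ab (-1)).
split=> [[m <-]|[y <-]]; last by exists (b 0 y).
by have [y <-] := ses_surj (ab 0) m; exists y.
Qed.

End Spliced.
End Splicing.

Lemma gorenstein_flat_of_class (R : pzRingType) (C : lmodType R -> Prop) (M : lmodType R) :
    let good (U F V : lmodType R) (a : {linear U -> F}) (b : {linear F -> V}) :=
      flat_module F /\
      forall J : lmodType R^c, injective_module J -> injective (rmap J a) in
    (forall Z, C Z -> exists2 Z', C Z' & link good Z' Z) ->
    (forall Z, C Z -> exists2 Z', C Z' & link good Z Z') ->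
    C M ->
  gorenstein_flat M.
Proof.
move=> good Cl Cr CM; have [Z [F [a [b [<- ab abg]]]]] := ex_splicing Cl Cr CM.
exists (spliced ab); split; [exact: spliced_acyclic | | | exact: spliced_syzygy].
  by move=> i; case: (abg i).
move=> J Ji i t.
have E k s : rmap J (spliced_diff a b k) s = rmap J (a k) (rmap J (b (1 + k)) s).
  by rewrite (tensor_map_comp (f := idfun) (g := spliced_diff a b k)).
have aI k : injective (rmap J (a k)) by case: (abg k) => _; apply.
rewrite /= E; split=> [t0|[s <-]]; last first.
  rewrite E (_ : rmap J (b (1 + i)) _ = 0) ?raddf0 //.
  by apply/(rmap_exact (ab (1 + i))); eexists.
have /(rmap_exact (ab (1 + i)))[s <-] : rmap J (b (1 + i)) t = 0.
  by apply: (aI i); rewrite t0 raddf0.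
have [y <-] := rmap_surj (ses_surj (ab (1 + (1 + i)))) s.
by exists y; rewrite E.
Qed.

Lemma gorenstein_injective_of_class (R : pzRingType) (C : lmodType R -> Prop)
    (M : lmodType R) :
    let good (U F V : lmodType R) (a : {linear U -> F}) (b : {linear F -> V}) :=
      injective_module F /\
      forall J : lmodType R, injective_module J -> lifts_along J b in
    (forall Z, C Z -> exists2 Z', C Z' & link good Z' Z) ->
    (forall Z, C Z -> exists2 Z', C Z' & link good Z Z') ->
    C M ->
  gorenstein_injective M.
Proof.
move=> good Cl Cr CM; have [Z [F [a [b [<- ab abg]]]]] := ex_splicing Cl Cr CM.
exists (spliced ab); split; [exact: spliced_acyclic | | | exact: spliced_syzygy].
  by move=> i; case: (abg i).
move=> J Ji i phi; rewrite /= /spliced_diff; split=> [phi0|[psi psiE] x]; last first.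
  by rewrite -psiE /= (sesK _ (ab (1 + i))) raddf0.
have [|h hE] := @lift_inj R (Z (1 + (1 + i))) (F (1 + i)) J (a (1 + i)) phi (ses_inj (ab _)).
  move=> x; apply/(ses_exact (ab (1 + i))); apply: (ses_inj (ab i)).
  by have /= -> := phi0 x; rewrite raddf0.
have [_ /(_ J Ji h)[psi psiE]] := abg (1 + (1 + i)).
by exists psi => x; rewrite /= psiE hE.
Qed.

(** * Duals of Gorenstein flat modules *)

(** [Z] is covered by the next term of [F]; an element killed by [rmap J a] lifts
    to a cycle there, which is a boundary because [F] stays exact after
    tensoring with [J], and boundaries map to zero in [Z]. *)
Lemma syzygy_tensor_inj (R : pzRingType) (F : complex R) (J : lmodType R^c)
    (Z V : lmodType R) (j : int) (a : {linear Z -> F (1 + j)})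
    (b : {linear F (1 + j) -> V}) (c : {linear V -> F j}) :
    acyclic F -> tensor_acyclic J F -> ses a b -> injective c ->
    (forall x, c (b x) = cdiff F j x) ->
  injective (rmap J a).
Proof.
move=> Fa FJ ab cI cb.
have aE x : (exists m, a m = x) <-> exists y, cdiff F (1 + j) y = x.
  split=> [/(ses_exact ab) bx0|/Fa]; first by apply/Fa; rewrite -cb bx0 raddf0.
  by rewrite -cb => cbx0; apply/(ses_exact ab)/cI; rewrite cbx0 raddf0.
have [|d dE] := @lift_inj R Z (F (1 + j)) (F (1 + (1 + j))) a (cdiff F (1 + j)) (ses_inj ab).
  by move=> v; apply/aE; exists v.
have dS z : exists y, d y = z.
  have /aE[y yE] : exists m, a m = a z by exists z.
  by exists y; apply: (ses_inj ab); rewrite dE.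
apply/tensor_map_inj => t at0; have [s sE] := rmap_surj dS t.
have /FJ[u uE] : rmap J (cdiff F (1 + j)) s = 0.
  rewrite -at0 -sE; symmetry.
  exact: (tensor_map_comp (f := idfun) (g := cdiff F (1 + j))).
rewrite -sE -uE; move: u {uE}.
apply: (tensor_hom_eq (f := rmap J d \o rmap J _) (g := \0)) => x y /=.
rewrite !tensor_map_tens (_ : d _ = 0) ?tens0r //.
by apply: (ses_inj ab); rewrite dE cdiffK raddf0.
Qed.

(** The duals of the syzygies of a complex [F] are linked by the duals of the
    terms of [F], which are injective; maps from an injective [J] lift because
    tensoring with [J] keeps the inclusions of the syzygies injective. *)
Lemma gorenstein_injective_dual (R : pzRingType) (M : lmodType R) :
  gorenstein_flat M -> gorenstein_injective (pontryagin_dual M : lmodType R^c).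
Proof.
move=> [F [Fa Ff FJ FM]].
pose C (Y : lmodType R^c) := exists2 Z, is_syzygy F Z & Y = pontryagin_dual Z.
apply: (@gorenstein_injective_of_class R^c C); last by exists M.
- move=> _ [Z FZ ->]; have [j [Z' [a [b [c [ab FZ' cI cb]]]]]] := syzygy_right Fa FZ.
  exists (pontryagin_dual Z' : lmodType R^c); first by exists Z'.
  exists (pontryagin_dual (F (1 + j)) : lmodType R^c), (dual_map b), (dual_map a).
  split; [exact: dual_ses | split; first exact/dual_injective/Ff].
  move=> J Ji phi; apply: dual_lifts.
  exact: syzygy_tensor_inj Fa (FJ J Ji) ab cI cb.
- move=> _ [Z FZ ->]; have [j [Z' [a [b [c [ab FZ' cI cb]]]]]] := syzygy_left Fa FZ.
  exists (pontryagin_dual Z' : lmodType R^c); first by exists Z'.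
  exists (pontryagin_dual (F (1 + j)) : lmodType R^c), (dual_map b), (dual_map a).
  split; [exact: dual_ses | split; first exact/dual_injective/Ff].
  move=> J Ji phi; apply: dual_lifts.
  exact: syzygy_tensor_inj Fa (FJ J Ji) ab cI cb.
Qed.

(** * Rings whose injective modules have finite flat dimension *)

Section FiniteSfli.
Variable R : pzRingType.
Implicit Types (A B D P Q V K L M N X Y Z : lmodType R) (C : lmodType R -> Prop).

(** The members of [C] have infinite coresolutions by modules of flat dimension
    at most [n], with cokernels again in [C]. *)
Definition coresolving n C : Prop :=
  forall Z, C Z -> exists X Z' (a : {linear Z -> X}) (b : {linear X -> Z'}),
    [/\ ses a b, tor_dim_le n X & C Z'].

Lemma pullback_lift A B D P V (f : {linear A -> D}) (g : {linear B -> D})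
    (p : {linear P -> A}) (q : {linear P -> B}) (u : {linear V -> A}) (v : {linear V -> B}) :
    pullback_of f g p q -> (forall x, f (u x) = g (v x)) ->
  exists h : {linear V -> P}, forall x, p (h x) = u x /\ q (h x) = v x.
Proof.
move=> pb fg; have H x := pb_ex pb (fg x).
pose h x := sval (cid (H x)); have hE x : p (h x) = u x /\ q (h x) = v x.
  by rewrite /h; case: cid.
have [|k kE] := @exists_lin R V P h; last by exists k => x; rewrite kE.
move=> r x y; apply/eqP; rewrite -subr_eq0; apply/eqP/(pb_inj pb).
  by rewrite raddfB /= linearP (hE _).1 (hE x).1 (hE y).1 linearP subrr.
by rewrite raddfB /= linearP (hE _).2 (hE x).2 (hE y).2 linearP subrr.
Qed.

(** The induction lowers [n].  Given [M -> X -> Z] and a free cover [e] of [X],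
    the preimage [N] of [M] in the free module is an extension of [M] by the
    kernel [K] of [e], for which the bound is one less than for [X].  These
    preimages again admit coresolutions, by fibre products of two free modules,
    whose flat dimension is bounded by that of such kernels.  An approximation
    [N -> L'] then gives the approximation of [M] by the quotient of [L'] by
    [K]. *)
Lemma approximation n C M : coresolving n C -> C M ->
  exists (D : lmodType R -> Prop) (L N : lmodType R) (a : {linear M -> L}) (b : {linear L -> N}),
    [/\ coresolving 0 D, ses a b, tor_dim_le n L & D N].
Proof.
elim: n => [|n IH] in C M *.
  by move=> HC /HC [X [Z [a [b [ab Xd CZ]]]]]; exists C, X, Z, a, b.
move=> HC CM.
pose C1 N := exists M1 X Z (a : {linear M1 -> X}) (b : {linear X -> Z})
  (e : {linear free_module R X -> X}) (p : {linear N -> free_module R X})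
  (q : {linear N -> M1}), [/\ ses a b, C Z, tor_dim_le n.+1 X,
    forall x, exists y, e y = x & pullback_of e a p q].
have HC1 : coresolving n C1.
  move=> N [M1 [X [Z [a [b [e [p [q [ab CZ Xd eS pb]]]]]]]]].
  have [X1 [Z1 [a1 [b1 [ab1 Xd1 CZ1]]]]] := HC Z CZ.
  have [e1 eS1] := free_cover X1.
  have [N1 [p1 [q1 pb1]]] := ex_pullback e1 a1.
  (* The middle term between the preimages of M1 and Z. *)
  have [Y [u [v pbY]]] := ex_pullback e1 (a1 \o (b \o e)).
  have [h hE] := pullback_lift (u := u) (v := (b \o e) \o v) pb1 (pb_comm pbY).
  have [|k kE] := pullback_lift (u := \0) (v := p) pbY.
    by move=> x; rewrite raddf0 /= (pb_comm pb) (sesK _ ab) raddf0.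
  have [K1 [i1 ie1]] := ex_ker_ses eS1.
  have [|j jE] := pullback_lift (u := i1) (v := \0) pbY.
    by move=> x; rewrite (sesK _ ie1) /= !raddf0.
  exists Y, N1, k, h; split; last first.
  - by exists Z, X1, Z1, a1, b1, e1, p1, q1.
  - have ses_jv : ses j v.
      split=> [|y|t].
      + apply/inj_lin => x jx0; apply: (ses_inj ie1).
        by rewrite -(jE x).1 jx0 !raddf0.
      + have [x xE] := eS1 (a1 (b (e y))).
        by have [t [_ tE]] := pb_ex pbY xE; exists t.
      split=> [vt0|[x <-]]; last by rewrite (jE x).2.
      have /(ses_exact ie1)[x xE] : e1 (u t) = 0 by rewrite (pb_comm pbY) /= vt0 !raddf0.
      exists x; apply/eqP; rewrite -subr_eq0; apply/eqP/(pb_inj pbY); rewrite raddfB /=.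
        by rewrite (jE x).1 xE subrr.
      by rewrite (jE x).2 vt0 subrr.
    move=> V; apply: tor_zero_ext ses_jv _ _; last exact/tor_zero_flat/free_flat.
    by apply/(tor_shift_r _ _ ie1 (@free_flat _ _)).
  split=> [|x|t].
  - apply/inj_lin => x kx0; have px0 : p x = 0 by rewrite -(kE x).2 kx0 raddf0.
    apply: (pb_inj pb) => //; apply: (ses_inj ab).
    by rewrite -(pb_comm pb) px0 !raddf0.
  - have [w wE] := ses_surj ab (q1 x); have [y yE] := eS w.
    have [|t [tu tv]] := pb_ex pbY (a := p1 x) (b := y).
      by rewrite /= yE wE (pb_comm pb1).
    exists t; apply/eqP; rewrite -subr_eq0; apply/eqP/(pb_inj pb1); rewrite raddfB /=.
      by rewrite (hE t).1 tu subrr.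
    by rewrite (hE t).2 /= tv yE wE subrr.
  split=> [ht0|[x <-]]; last first.
    apply: (pb_inj pb1); first by rewrite (hE _).1 (kE _).1.
    by rewrite (hE _).2 /= (kE _).2 (pb_comm pb) (sesK _ ab).
  have ut0 : u t = 0 by rewrite -(hE t).1 ht0 raddf0.
  have /(ses_exact ab)[m mE] : b (e (v t)) = 0.
    by have /= <- := (hE t).2; rewrite ht0 raddf0.
  have [x [px qx]] := pb_ex pb (esym mE).
  exists x; apply/eqP; rewrite -subr_eq0; apply/eqP/(pb_inj pbY); rewrite raddfB /=.
    by rewrite (kE x).1 ut0 subr0.
  by rewrite (kE x).2 px subrr.
have [X [Z [a [b [ab Xd CZ]]]]] := HC M CM.
have [e eS] := free_cover X; have [N [p [q pb]]] := ex_pullback e a.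
have C1N : C1 N by exists M, X, Z, a, b, e, p, q.
have [D [L' [Q [a' [b' [HD ab' L'd DQ]]]]]] := IH C1 N HC1 C1N.
have [K [i ie]] := ex_ker_ses eS.
have qS m : exists x, q x = m.
  by have [y yE] := eS (a m); have [x [_ xE]] := pb_ex pb yE; exists x.
have [|j jE] := pullback_lift (u := i) (v := \0) pb.
  by move=> x; rewrite (sesK _ ie) raddf0.
have jq x : q x = 0 -> exists y, j y = x.
  move=> qx0; have /(ses_exact ie)[y yE] : e (p x) = 0 by rewrite (pb_comm pb) qx0 raddf0.
  exists y; apply/eqP; rewrite -subr_eq0; apply/eqP/(pb_inj pb); rewrite raddfB /=.
    by rewrite (jE y).1 yE subrr.
  by rewrite (jE y).2 qx0 subrr.
have jI : injective j.
  by apply/inj_lin => x jx0; apply: (ses_inj ie); rewrite -(jE x).1 jx0 !raddf0.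
have a'jI : injective (a' \o j) by move=> x y /= /(ses_inj ab')/jI.
have [L [pi api]] := @ex_coker_ses R K L' (a' \o j) a'jI.
have [|al alE] := @factor_surj R N M L q (pi \o a') qS.
  by move=> x /jq[y <-]; apply: (sesK y api).
have [|be beE] := @factor_surj R L' L Q pi b' (ses_surj api).
  by move=> x /(ses_exact api)[y <-]; apply: (sesK (j y) ab').
exists D, L, Q, al, be; split=> //; last first.
  move=> V; apply: tor_zero_coker api _ _; last exact/tor_dimS.
  by apply/(tor_shift_r _ _ ie (@free_flat _ _)).
split=> [|z|l].
- apply/inj_lin => m; have [x <-] := qS m; rewrite /= alE => /(ses_exact api)[y].
  by move=> /(ses_inj ab') <-; rewrite (jE y).2.
- by have [x <-] := ses_surj ab' z; exists (pi x).
have [x <-] := ses_surj api l; rewrite beE; split=> [/(ses_exact ab')[y <-]|[m mE]].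
  by exists (q y); apply: alE.
have [y yE] := qS m; move: mE; rewrite -yE alE => /= /eqP.
rewrite -subr_eq0 -raddfB => /eqP/(ses_exact api)[w wE].
have -> : x = a' (y - j w) by rewrite raddfB /= [a' (j w)]wE subKr.
exact: sesK ab'.
Qed.

(** Shifting along the flat coresolution of [Z] raises the degree until the
    vanishing for all modules applies. *)
Lemma tor_zero_coresolving C J i Z d :
    coresolving 0 C -> C Z -> (forall N, tor_zero (i + d) J N) -> tor_zero i J Z.
Proof.
move=> HC; elim: d i Z => [|d IH] i Z CZ T; first by rewrite addn0 in T.
have [X [Z' [a [b [ab /tor_dim0 Xf CZ']]]]] := HC Z CZ.
by apply/(tor_shift_r _ _ ab Xf)/IH => // N; rewrite addSnnS.
Qed.

(** Vanishing of all higher Tor against injective right modules: the condition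
    that characterises Gorenstein flat modules over the rings considered here. *)
Definition tor_acyclic Z : Prop :=
  forall (J : lmodType R^c) i, injective_module J -> tor_zero i J Z.

(** By induction the first syzygy [K] is flat.  A right module [X] embeds in an
    injective [J]; tensoring [X] with [K] then maps injectively to the tensor
    product of [J] with [K], and from there to that of [J] with the free module,
    because Tor_1(J, L) vanishes. *)
Lemma tor_acyclic_flat n L : tor_dim_le n L -> tor_acyclic L -> flat_module L.
Proof.
elim: n => [|n IH] in L *; first by move=> /tor_dim0.
move=> Ld La; have [K [a [b ab]]] := free_ses L; have Ff := @free_flat R L.
have Kf : flat_module K.
  apply: IH; first exact/(tor_dim_shift _ ab Ff).
  by move=> J i Ji; apply/(tor_shift_r _ _ ab Ff)/La.
apply: tor_dim0 => X; apply: (tor0_of_r ab Ff).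
have [J [k [Ji kI]]] := enough_injectives X.
move=> s t st; apply: (Kf _ _ k kI); apply: (tor0_rmap ab (La J 0%N Ji)).
by rewrite -!lmap_rmap st.
Qed.

Hypothesis left_dim : exists n, forall E : lmodType R, injective_module E -> tor_dim_le n E.
Hypothesis right_dim : forall J : lmodType R^c, injective_module J ->
  exists n, forall N, tor_zero n J N.

(** In the approximation [M -> L -> N] the module [N] is Tor-acyclic by its flat
    coresolution, so [L] is Tor-acyclic too, and its finite flat dimension makes
    it flat. *)
Lemma tor_acyclic_embeds M : tor_acyclic M ->
  exists L N (a : {linear M -> L}) (b : {linear L -> N}),
    [/\ ses a b, flat_module L & tor_acyclic N].
Proof.
move=> Ma; have [n nE] := left_dim.
have HT : coresolving n (fun _ => True).
  move=> Z _; have [E [a [Ei aI]]] := enough_injectives Z.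
  have [Z' [b ab]] := ex_coker_ses aI; exists E, Z', a, b; split=> //.
  exact: nE.
have [C [L [N [a [b [HC ab Ld CN]]]]]] := approximation HT (I : (fun _ => True) M).
have Na : tor_acyclic N.
  move=> J i Ji; have [d dE] := right_dim Ji; apply: (tor_zero_coresolving (d := d) HC CN).
  by elim: i => [//|i IH] Z; have [K [c [e ce]]] := free_ses Z;
    apply/(tor_shift_r _ _ ce (@free_flat _ _)).
exists L, N, a, b; split=> //; apply: tor_acyclic_flat Ld _ => J i Ji.
by apply: tor_zero_ext ab (Ma J i Ji) (Na J i Ji).
Qed.

Lemma gorenstein_flat_of_tor M : tor_acyclic M -> gorenstein_flat M.
Proof.
move=> Ma; apply: (@gorenstein_flat_of_class R tor_acyclic) => // Z Za.
  have [K [a [b ab]]] := free_ses Z; have Ff := @free_flat R Z.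
  exists K; first by move=> J i Ji; apply/(tor_shift_r _ _ ab Ff)/Za.
  exists (free_module R Z), a, b; split=> //; split=> // J Ji.
  exact: tor0_rmap ab (Za J 0%N Ji).
have [L [N [a [b [ab Lf Na]]]]] := tor_acyclic_embeds Za.
exists N => //; exists L, a, b; split=> //; split=> // J Ji.
exact: tor0_rmap ab (Na J 0%N Ji).
Qed.

Lemma gorenstein_flat_of_dual M :
  gorenstein_injective (pontryagin_dual M : lmodType R^c) -> gorenstein_flat M.
Proof.
move=> DM; apply: gorenstein_flat_of_tor => J i Ji.
exact: tor_of_gorenstein_injective DM Ji.
Qed.

End FiniteSfli.

(** * Modules over group rings *)

Section GroupRingFacts.
Variables (k : comPzRingType) (G : groupType).
Local Notation kG := (group_ring k G).

Lemma gr_monomD c d (g : G) : gr_monom (c + d) g = gr_monom c g + gr_monom d g :> kG.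
Proof. exact: monalgUD. Qed.

Lemma gr_constC (c : k) (x : kG) : gr_const G c * x = x * gr_const G c.
Proof.
elim/gr_ind: x => [|x y Hx Hy|d g]; first by rewrite mul0r mulr0.
  by rewrite mulrDl mulrDr Hx Hy.
by rewrite /gr_const !gr_monomM mul1g mulg1 mulrC.
Qed.

Lemma gr_monom_const (c : k) (g : G) : gr_monom c g = gr_const G c * gr_monom 1 g.
Proof. by rewrite gr_monomM mulr1 mul1g. Qed.

Lemma gr_linear (A B : lmodType kG) (f : {additive A -> B}) :
  (forall (c : k) (g : G) a, f ((gr_monom c g : kG) *: a) = (gr_monom c g : kG) *: f a) -> linear f.
Proof.
move=> fZ x a b; rewrite raddfD; congr (_ + _).
elim/gr_ind: x => [|x y Hx Hy|//]; first by rewrite !scale0r raddf0.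
by rewrite !scalerDl raddfD /= Hx Hy.
Qed.

Definition antipode_fun (x : kG) : kG := \sum_(g <- msupp x) @gr_monom k G (x@_g) (g^-1)%g.

Lemma antipodeB : zmod_morphism antipode_fun.
Proof.
by apply: (@malg_sumB _ _ _ (fun g c => gr_monom c (g^-1)%g : kG)) => g; apply: gr_monomB.
Qed.

Lemma antipodeU c g : antipode_fun (gr_monom c g) = gr_monom c (g^-1)%g.
Proof.
by apply: (@malg_sumU _ _ _ (fun g c => gr_monom c (g^-1)%g : kG)) => h; apply: gr_monomB.
Qed.

HB.instance Definition _ := GRing.isZmodMorphism.Build kG kG antipode_fun antipodeB.

Lemma antipodeM x y : antipode_fun (x * y) = antipode_fun y * antipode_fun x.
Proof.
elim/gr_ind: x => [|x1 x2 H1 H2|c g]; first by rewrite mul0r !raddf0 mulr0.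
  by rewrite mulrDl !raddfD /= H1 H2 mulrDr.
elim/gr_ind: y => [|y1 y2 H1 H2|d h]; first by rewrite mulr0 !raddf0 mul0r.
  by rewrite mulrDr !raddfD /= H1 H2 mulrDl.
by rewrite gr_monomM !antipodeU gr_monomM invgM mulrC.
Qed.

Lemma antipode1 : antipode_fun 1 = 1.
Proof. by rewrite antipodeU invg1. Qed.

Lemma antipodeK x : antipode_fun (antipode_fun x) = x.
Proof.
elim/gr_ind: x => [|x1 x2 H1 H2|c g]; first by rewrite !raddf0.
  by rewrite !raddfD /= H1 H2.
by rewrite !antipodeU invgK.
Qed.

Lemma antipode_monoid : monoid_morphism (antipode_fun : kG -> kG^c).
Proof. by split=> [|x y]; [exact: antipode1|exact: antipodeM]. Qed.
Lemma antipode'_monoid : monoid_morphism (antipode_fun : kG^c -> kG).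
Proof. by split=> [|x y]; [exact: antipode1|exact: antipodeM]. Qed.

(** The two directions of the anti-isomorphism of a group ring with itself. *)
Definition antipode : {rmorphism kG -> kG^c} :=
  HB.pack (antipode_fun : kG -> kG^c)
    (GRing.isZmodMorphism.Build kG kG^c antipode_fun antipodeB)
    (GRing.isMonoidMorphism.Build kG kG^c antipode_fun antipode_monoid).
Definition antipode' : {rmorphism kG^c -> kG} :=
  HB.pack (antipode_fun : kG^c -> kG)
    (GRing.isZmodMorphism.Build kG^c kG antipode_fun antipodeB)
    (GRing.isMonoidMorphism.Build kG^c kG antipode_fun antipode'_monoid).

Lemma antipodeE x : antipode x = antipode_fun x.
Proof. by []. Qed.
Lemma antipode'E x : antipode' x = antipode_fun x.
Proof. by []. Qed.

End GroupRingFacts.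

Section Diagonal.
Variables (k : comPzRingType) (G : groupType).
Local Notation kG := (group_ring k G).

Definition conv_fun : k^c -> k := fun c => c.
Lemma conv_funB : zmod_morphism conv_fun. Proof. by []. Qed.
Lemma conv_funM : monoid_morphism conv_fun.
Proof. by split=> // x y; rewrite /conv_fun [RHS]mulrC. Qed.
HB.instance Definition _ := GRing.isZmodMorphism.Build k^c k conv_fun conv_funB.
HB.instance Definition _ := GRing.isMonoidMorphism.Build k^c k conv_fun conv_funM.

(** The underlying k-module as a right module, the form required of a left
    tensor factor. *)
Definition rbase (W : lmodType kG) : lmodType k^c :=
  restr (conv_fun : {rmorphism k^c -> k}) (base_module W).
Definition rbase_map (V W : lmodType kG) (f : {linear V -> W}) :
  {linear rbase V -> rbase W} := restr_lin conv_fun (base_map f).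

Lemma rbaseZ (W : lmodType kG) (c : k^c) (w : W) :
  @GRing.scale _ (rbase W) c w = gr_const G (c : k) *: w.
Proof. by []. Qed.
Lemma baseZ (W : lmodType kG) (c : k) (w : W) :
  @GRing.scale _ (base_module W) c w = gr_const G c *: w.
Proof. by []. Qed.

Section Action.
Variables (W U : lmodType kG).

Lemma ex_mono_base (c : k) (g : G) :
  exists f : {linear base_module U -> base_module U}, forall u, f u = gr_monom c g *: (u : U).
Proof.
apply: exists_lin => d u v; rewrite !baseZ scalerDr; congr (_ + _).
by rewrite !scalerA gr_constC.
Qed.

Lemma ex_mono_rbase (c : k) (g : G) :
  exists f : {linear rbase W -> rbase W}, forall w, f w = gr_monom c g *: (w : W).
Proof.
apply: exists_lin => d u v; rewrite !rbaseZ scalerDr; congr (_ + _).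
by rewrite !scalerA gr_constC.
Qed.

Definition mono_base c g := sval (cid (ex_mono_base c g)).
Definition mono_rbase c g := sval (cid (ex_mono_rbase c g)).
Lemma mono_baseE c g u : mono_base c g u = gr_monom c g *: (u : U).
Proof. by rewrite /mono_base; case: cid => f /= ->. Qed.
Lemma mono_rbaseE c g w : mono_rbase c g w = gr_monom c g *: (w : W).
Proof. by rewrite /mono_rbase; case: cid => f /= ->. Qed.

Definition diag_carrier : Type := tensor (rbase W) (base_module U).
HB.instance Definition _ := GRing.Zmodule.on diag_carrier.

Definition dtens (w : W) (u : U) : diag_carrier := @tens k (rbase W) (base_module U) w u.

Definition diag_act (c : k) (g : G) (t : diag_carrier) : diag_carrier :=
  tensor_map (mono_rbase c g) (mono_base 1 g) t.

Lemma diag_actE c g w u :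
  diag_act c g (dtens w u) = dtens (gr_monom c g *: w) (gr_monom 1 g *: u).
Proof.
by rewrite /diag_act /dtens tensor_map_tens mono_rbaseE mono_baseE.
Qed.

Lemma dtensDl w w' u : dtens (w + w') u = dtens w u + dtens w' u.
Proof. exact: tensDl. Qed.
Lemma dtensDr w u u' : dtens w (u + u') = dtens w u + dtens w u'.
Proof. exact: tensDr. Qed.
Lemma dtensZ (c : k) w u : dtens (gr_const G c *: w) u = dtens w (gr_const G c *: u).
Proof. exact: (@tensZ k (rbase W) (base_module U) w c u). Qed.

Lemma dtens_ind (P : diag_carrier -> Prop) :
    P 0 -> (forall s t, P s -> P t -> P (s + t)) ->
    (forall w u, P (dtens w u)) ->
  forall t, P t.
Proof. exact: tensor_ind. Qed.

(** A monomial [gr_monom c g] acts by [g] on both factors and by [c] on one of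
    them. *)
Lemma ex_diag_scale : exists s : kG -> diag_carrier -> diag_carrier,
  [/\ forall x y t, s (x + y) t = s x t + s y t,
      forall x t u, s x (t + u) = s x t + s x u
    & forall c g w u, s (gr_monom c g) (dtens w u) =
        dtens (gr_monom c g *: w) (gr_monom 1 g *: u)].
Proof.
have act0 c g : diag_act c g 0 = 0 by apply: raddf0 (tensor_map _ _).
have actD c g s t : diag_act c g (s + t) = diag_act c g s + diag_act c g t.
  exact: raddfD (tensor_map _ _) s t.
have actDl c d g t : diag_act (c + d) g t = diag_act c g t + diag_act d g t.
  elim/dtens_ind: t => [|s t Hs Ht|w u].
  - by rewrite (act0 c) (act0 d) (act0 (c + d)) addr0.
  - rewrite (actD c) (actD d) (actD (c + d)) Hs Ht; exact: addrACA.
  - by rewrite (diag_actE c) (diag_actE d) (diag_actE (c + d)) gr_monomD scalerDl dtensDl.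
have actB t g : zmod_morphism (fun c => diag_act c g t).
  by move=> c d; apply/eqP; rewrite eq_sym subr_eq -actDl subrK.
exists (fun x t => \sum_(g <- msupp x) diag_act (x@_g) g t); split=> [x y t|x t u|c g w u].
- have [h hE] := exists_add (malg_sumB (actB t)).
  exact: etrans (esym (hE _)) (etrans (raddfD h x y) (f_equal2 +%R (hE x) (hE y))).
- rewrite -big_split /=; apply: eq_bigr => g _; exact: raddfD (tensor_map _ _) t u.
- exact: etrans (malg_sumU (actB (dtens w u)) g c) (diag_actE c g w u).
Qed.

Definition diag_scale := sval (cid ex_diag_scale).

Lemma diag_scaleDl t : {morph diag_scale^~ t : x y / x + y}.
Proof. by have [h _ _] := svalP (cid ex_diag_scale); move=> x y; apply: h. Qed.
Lemma diag_scaleDr : right_distributive diag_scale +%R.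
Proof. by have [_ h _] := svalP (cid ex_diag_scale); move=> x y t; apply: h. Qed.
Lemma diag_scaleE c g w u : diag_scale (gr_monom c g) (dtens w u) =
  dtens (gr_monom c g *: w) (gr_monom 1 g *: u).
Proof. by have [_ _ h] := svalP (cid ex_diag_scale); apply: h. Qed.
Lemma diag_scale0l t : diag_scale 0 t = 0.
Proof. by apply: (addIr (diag_scale 0 t)); rewrite -diag_scaleDl addr0 add0r. Qed.
Lemma diag_scale0r x : diag_scale x 0 = 0.
Proof. by apply: (addIr (diag_scale x 0)); rewrite -diag_scaleDr addr0 add0r. Qed.

Lemma diag_scaleA x y t : diag_scale x (diag_scale y t) = diag_scale (x * y) t.
Proof.
elim/dtens_ind: t => [|s t Hs Ht|w u]; first by rewrite !diag_scale0r.
  by rewrite !diag_scaleDr Hs Ht.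
elim/gr_ind: y => [|y z Hy Hz|d h].
- by rewrite mulr0 !diag_scale0l diag_scale0r.
- by rewrite mulrDr !diag_scaleDl diag_scaleDr Hy Hz.
elim/gr_ind: x => [|x z Hx Hz|c g].
- by rewrite mul0r !diag_scale0l.
- by rewrite mulrDl !diag_scaleDl Hx Hz.
by rewrite gr_monomM !diag_scaleE !scalerA !gr_monomM mul1r.
Qed.

Lemma diag_scale1 : left_id 1 diag_scale.
Proof.
elim/dtens_ind => [|s t Hs Ht|w u]; first exact: diag_scale0r.
  by rewrite diag_scaleDr Hs Ht.
by rewrite -[X in diag_scale X _]/(gr_monom 1 1%g) diag_scaleE !scale1r.
Qed.

HB.instance Definition _ := GRing.Zmodule_isLmodule.Build kG diag_carrier
  diag_scaleA diag_scale1 diag_scaleDr diag_scaleDl.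

End Action.

(** The tensor product over k with the diagonal action of G. *)
Definition diag (W U : lmodType kG) : lmodType kG := diag_carrier W U.

Definition dt (W U : lmodType kG) (w : W) (u : U) : diag W U := dtens w u.

Lemma diagZ (W U : lmodType kG) c g (w : W) (u : U) :
  gr_monom c g *: dt w u = dt (gr_monom c g *: w) (gr_monom 1 g *: u).
Proof. exact: diag_scaleE. Qed.

Lemma diagZk (W U : lmodType kG) c (w : W) (u : U) :
  gr_const G c *: dt w u = dt (gr_const G c *: w) u.
Proof. by rewrite diagZ [gr_monom 1 1%g *: u]scale1r. Qed.

End Diagonal.

Lemma scale_add0 (R : pzRingType) (A B : lmodType R) (f : {additive A -> B}) (r : R) :
  f (r *: 0) = r *: f 0.
Proof. by rewrite scaler0 !raddf0. Qed.
Lemma scale_addD (R : pzRingType) (A B : lmodType R) (f : {additive A -> B}) (r : R) s t :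
  f (r *: s) = r *: f s -> f (r *: t) = r *: f t -> f (r *: (s + t)) = r *: f (s + t).
Proof. by move=> Hs Ht; rewrite scalerDr !raddfD /= Hs Ht. Qed.

Section DiagonalMaps.
Variables (k : comPzRingType) (G : groupType).
Local Notation kG := (group_ring k G).
Implicit Types (U V W : lmodType kG).

Lemma dtDl W U (w w' : W) (u : U) : dt (w + w') u = dt w u + dt w' u.
Proof. exact: dtensDl. Qed.
Lemma dtDr W U (w : W) (u u' : U) : dt w (u + u') = dt w u + dt w u'.
Proof. exact: dtensDr. Qed.
Lemma dtZ W U (c : k) (w : W) (u : U) :
  dt (gr_const G c *: w) u = dt w (gr_const G c *: u).
Proof. exact: dtensZ. Qed.

Lemma dt_ind W U (P : diag W U -> Prop) :
    P 0 -> (forall s t, P s -> P t -> P (s + t)) -> (forall w u, P (dt w u)) ->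
  forall t, P t.
Proof. exact: dtens_ind. Qed.

Lemma diag_hom_eq W U (V : zmodType) (f g : {additive diag W U -> V}) :
  (forall w u, f (dt w u) = g (dt w u)) -> f =1 g.
Proof.
by move=> fg; apply: dt_ind => [|s t Hs Ht|//]; rewrite ?raddf0 // !raddfD Hs Ht.
Qed.

Lemma ex_diag_lift W U (V : zmodType) (f : W -> U -> V) :
    (forall w w' u, f (w + w') u = f w u + f w' u) ->
    (forall w u u', f w (u + u') = f w u + f w u') ->
    (forall c w u, f (gr_const G c *: w) u = f w (gr_const G c *: u)) ->
  exists h : {additive diag W U -> V}, forall w u, h (dt w u) = f w u.
Proof.
move=> fl fr fz.
have [|h hE] := @ex_tensor_lift k (rbase W) (base_module U) V f.
  by split; [exact: fl|exact: fr|move=> w c u; exact: fz c w u].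
by exists h => w u; apply: hE.
Qed.

Lemma ex_diag_map W W' U U' (f : {linear W -> W'}) (g : {linear U -> U'}) :
  exists h : {linear diag W U -> diag W' U'},
    (forall w u, h (dt w u) = dt (f w) (g u)) /\
    (forall t, h t = tensor_map (rbase_map f) (base_map g) t).
Proof.
have [h hE] : exists h : {additive diag W U -> diag W' U'},
    forall t, h t = tensor_map (rbase_map f) (base_map g) t.
  by exists (tensor_map (rbase_map f) (base_map g)).
have hE' w u : h (dt w u) = dt (f w) (g u).
  by rewrite hE; apply: (tensor_map_tens (rbase_map f) (base_map g)).
have [|l lE] := @exists_lin kG (diag W U) (diag W' U') h.
  apply: gr_linear => c x; elim/dt_ind => [|s t Hs Ht|w u].
  - exact: scale_add0.
  - exact: scale_addD Hs Ht.
  - by rewrite diagZ !hE' diagZ !linearZZ.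
by exists l; split=> [w u|t]; rewrite lE.
Qed.

Lemma base_ses U V W (a : {linear U -> V}) (b : {linear V -> W}) :
  ses a b -> ses (base_map a) (base_map b).
Proof. by case. Qed.
Lemma rbase_ses U V W (a : {linear U -> V}) (b : {linear V -> W}) :
  ses a b -> ses (rbase_map a) (rbase_map b).
Proof. by case. Qed.

Lemma rmap_rbase W U U' (a : {linear U' -> U}) t :
  tensor_map (rbase_map (idfun : {linear W -> W})) (base_map a) t
  = rmap (rbase W) (base_map a) t.
Proof. by []. Qed.
Lemma lmap_base W W' U (a : {linear W' -> W}) t :
  tensor_map (rbase_map a) (base_map (idfun : {linear U -> U})) t
  = lmap (rbase_map a) (base_module U) t.
Proof. by []. Qed.

(** Exactness of the diagonal tensor product is that of the underlying tensor
    product over k. *)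
Lemma diag_ses_r W U' U U'' (a : {linear U' -> U}) (b : {linear U -> U''}) :
    ses a b -> flat_module (base_module U'') ->
  exists (a' : {linear diag W U' -> diag W U}) (b' : {linear diag W U -> diag W U''}),
    ses a' b'.
Proof.
move=> ab Uf; have [a' [_ a'E]] := ex_diag_map (idfun : {linear W -> W}) a.
have [b' [_ b'E]] := ex_diag_map (idfun : {linear W -> W}) b.
have ab' := base_ses ab.
exists a', b'; split=> [s t|t|t].
- rewrite !a'E !rmap_rbase; apply: (tor0_rmap ab'); exact: tor_zero_flat.
- have [s sE] := rmap_surj (X := rbase W) (ses_surj ab') t.
  by exists s; rewrite b'E.
- have E := rmap_exact (X := rbase W) ab' t; rewrite b'E rmap_rbase.
  split=> [/E [s sE]|[s sE]]; first by exists s; rewrite a'E.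
  by apply/E; exists s; rewrite -sE a'E.
Qed.

Lemma diag_ses_l U W' W W'' (a : {linear W' -> W}) (b : {linear W -> W''}) :
    ses a b -> flat_module (base_module U) ->
  exists (a' : {linear diag W' U -> diag W U}) (b' : {linear diag W U -> diag W'' U}),
    ses a' b'.
Proof.
move=> ab Uf; have [a' [_ a'E]] := ex_diag_map a (idfun : {linear U -> U}).
have [b' [_ b'E]] := ex_diag_map b (idfun : {linear U -> U}).
have ab' := rbase_ses ab.
exists a', b'; split=> [s t|t|t].
- by rewrite !a'E !lmap_base; apply: Uf (ses_inj ab') _ _.
- have [s sE] := lmap_surj (N := base_module U) (ses_surj ab') t.
  by exists s; rewrite b'E.
- have E := lmap_exact (N := base_module U) ab' t; rewrite b'E lmap_base.
  split=> [/E [s sE]|[s sE]]; first by exists s; rewrite a'E.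
  by apply/E; exists s; rewrite -sE a'E.
Qed.

End DiagonalMaps.

Section DiagonalFlat.
Variables (k : comPzRingType) (G : groupType).
Local Notation kG := (group_ring k G).

(** Right modules as left ones, and conversely, through the inversion of [G]. *)
Definition to_left (X : lmodType kG^c) : lmodType kG := restr (antipode k G) X.
Definition to_right (V : lmodType kG) : lmodType kG^c := restr (antipode' k G) V.

Lemma to_leftZ (X : lmodType kG^c) c g (x : X) :
  @GRing.scale _ (to_left X) (gr_monom c g) x = (gr_monom c (g^-1)%g : kG^c) *: x.
Proof. by rewrite -[LHS]/(antipode k G _ *: _) antipodeE antipodeU. Qed.
Lemma to_rightZ (V : lmodType kG) c g (v : V) :
  @GRing.scale _ (to_right V) (gr_monom c g) v = (gr_monom c (g^-1)%g : kG) *: v.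
Proof. by rewrite -[LHS]/(antipode' k G _ *: _) antipode'E antipodeU. Qed.

Section Assoc.
Variables (X : lmodType kG^c) (W P : lmodType kG).
Local Notation XW := (to_right (diag (to_left X) W)).

Lemma balanced_mono (Y : lmodType kG^c) (N : lmodType kG) (V : zmodType)
    (f : Y -> N -> V) :
    (forall x y n, f (x + y) n = f x n + f y n) ->
    (forall x m n, f x (m + n) = f x m + f x n) ->
    (forall x c g n, f ((gr_monom c g : kG^c) *: x) n = f x (gr_monom c g *: n)) ->
  balanced f.
Proof.
move=> fl fr fz; split=> // x r n.
have f0l m : f 0 m = 0 by apply: (addIr (f 0 m)); rewrite -fl addr0 add0r.
have f0r y : f y 0 = 0 by apply: (addIr (f y 0)); rewrite -fr addr0 add0r.
elim/gr_ind: r => [|r s Hr Hs|c g]; first by rewrite !scale0r f0l f0r.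
  by rewrite !scalerDl fl fr Hr Hs.
exact: fz.
Qed.

(** The associativity map [x, (w, p)] to [(x, w), p]; it is balanced over the
    group ring because [G] acts on [X] through inverses on the right-hand
    side. *)
Lemma ex_assoc : exists h : {additive tensor X (diag W P) -> tensor XW P},
  forall x w p, h (tens x (dt w p)) = tens (dt (x : to_left X) w : XW) p.
Proof.
have H (x : X) : exists h : {additive diag W P -> tensor XW P},
    forall w p, h (dt w p) = tens (dt (x : to_left X) w : XW) p.
  apply: ex_diag_lift => [w w' p|w p p'|c w p].
  - by rewrite dtDr tensDl.
  - exact: tensDr.
  - rewrite -dtZ -diagZk; rewrite -[RHS]tensZ; congr (tens _ p).
    by rewrite to_rightZ invg1.
pose h x := sval (cid (H x)); have hE x w p : h x (dt w p) = tens (dt (x : to_left X) w : XW) p.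
  by rewrite /h; case: cid.
have [|l lE] := @ex_tensor_lift kG X (diag W P) (tensor XW P) (fun x t => h x t).
  apply: balanced_mono => [x y t|x s t|x c g t]; last first.
  - apply: (diag_hom_eq (f := h (_ *: x)) (g := h x \o ( *:%R (gr_monom c g)))) t => w p /=.
    apply: etrans (hE _ w p) _; apply: etrans _ (esym (congr1 (h x) (diagZ c g w p))).
    apply: etrans _ (esym (hE x _ _)); apply: etrans _ (tensZ _ _ _).
    congr (tens _ p); apply: etrans _ (esym (to_rightZ _ _ _)).
    apply: etrans _ (esym (diagZ _ _ _ _)).
    have -> : gr_monom 1 (g^-1)%g *: (gr_monom c g *: w) = gr_const G c *: w.
      by rewrite scalerA gr_monomM mulVg mul1r.
    apply: etrans _ (dtZ _ _ _); congr (dt _ w).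
    have := to_leftZ c (g^-1)%g x; rewrite invgK => <-.
    by rewrite scalerA gr_monomM mul1g mulr1.
  - exact: raddfD.
  apply: (diag_hom_eq (f := h (x + y)) (g := h x \+ h y)) t => w p /=.
  apply: etrans (hE _ w p) _.
  apply: etrans (f_equal (fun d => tens (d : XW) p) (dtDl (x : to_left X) y w)) _.
  apply: etrans (tensDl _ _ _) _.
  exact: (f_equal2 +%R (esym (hE x w p)) (esym (hE y w p))).
by exists l => x w p; rewrite lE hE.
Qed.

Lemma ex_assoc' : exists h : {additive tensor XW P -> tensor X (diag W P)},
  forall x w p, h (tens (dt (x : to_left X) w : XW) p) = tens x (dt w p).
Proof.
have H (p : P) : exists h : {additive diag (to_left X) W -> tensor X (diag W P)},
    forall x w, h (dt (x : to_left X) w) = tens (x : X) (dt w p).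
  apply: ex_diag_lift => [x y w|x w w'|c x w].
  - exact: tensDl.
  - by rewrite dtDl tensDr.
  - rewrite -diagZk; rewrite -[RHS]tensZ; congr (tens _ (dt w p)).
    by rewrite to_leftZ invg1.
pose h p := sval (cid (H p)).
have hE p x w : h p (dt (x : to_left X) w) = tens (x : X) (dt w p).
  by rewrite /h; case: cid.
have [|l lE] := @ex_tensor_lift kG XW P (tensor X (diag W P)) (fun t p => h p t).
  apply: balanced_mono => [s t p|t p q|t c g p].
  - exact: raddfD.
  - apply: (diag_hom_eq (f := h (p + q)) (g := h p \+ h q)) t => x w /=.
    apply: etrans (hE _ x w) _; apply: etrans (f_equal (tens (x : X)) (dtDr w p q)) _.
    apply: etrans (tensDr _ _ _) _.
    exact: (f_equal2 +%R (esym (hE p x w)) (esym (hE q x w))).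
  apply: etrans (f_equal (h p) (to_rightZ _ _ _)) _.
  apply: (diag_hom_eq (f := h p \o ( *:%R (gr_monom c (g^-1)%g))) (g := h _)) t => x w /=.
  apply: etrans (f_equal (h p) (diagZ c (g^-1)%g x w)) _.
  apply: etrans (hE p _ _) _; apply: etrans _ (esym (hE _ x w)).
  apply: etrans (f_equal (fun y => tens (y : X) _) (to_leftZ _ _ _)) _.
  apply: etrans (tensZ _ _ _) _; congr (tens x _); rewrite invgK.
  apply: etrans (diagZ _ _ _ _) _; rewrite scalerA gr_monomM mulgV mulr1.
  apply: etrans (dtZ _ _ _) _; congr (dt w _).
  by rewrite scalerA gr_monomM mul1g mulr1.
by exists l => x w p; rewrite lE hE.
Qed.

End Assoc.

(** Tensoring over the group ring with [diag W P] amounts, by associativity, to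
    tensoring over k with [W] and then over the group ring with [P]. *)
Lemma diag_flat (W P : lmodType kG) :
  flat_module (base_module W) -> flat_module P -> flat_module (diag W P).
Proof.
move=> Wf Pf X Y f fI.
have [hX hXE] := ex_assoc X W P; have [hY hYE] := ex_assoc Y W P.
have [kX kXE] := ex_assoc' X W P.
have hXI : injective hX.
  apply: (can_inj (g := kX)).
  apply: (tensor_hom_eq (f := kX \o hX) (g := idfun)) => x t /=.
  apply: (diag_hom_eq (f := kX \o hX \o tens x) (g := tens x)) t => w p /=.
  exact: etrans (f_equal kX (hXE x w p)) (kXE x w p).
have [F [FE Fmap]] := ex_diag_map (restr_lin (antipode k G) f) (idfun : {linear W -> W}).
have FI : injective F.
  by move=> s t; rewrite !Fmap !lmap_base; apply: Wf.
pose F' := restr_lin (antipode' k G) F.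
have E t : hY (lmap f (diag W P) t) = lmap F' P (hX t).
  move: t; apply: (tensor_hom_eq (f := hY \o lmap f _) (g := lmap F' P \o hX)) => x t /=.
  apply: (diag_hom_eq (f := hY \o lmap f _ \o tens x) (g := lmap F' P \o hX \o tens x)) t.
  move=> w p /=.
  apply: etrans (f_equal hY (tensor_map_tens _ _ _ _)) _; apply: etrans (hYE _ _ _) _.
  apply: etrans _ (esym (f_equal (lmap F' P) (hXE x w p))).
  apply: etrans _ (esym (tensor_map_tens _ _ _ _)).
  by congr (tens _ p); apply: esym; apply: FE.
by move=> s t st; apply/hXI/(Pf _ _ F' FI); rewrite -!E st.
Qed.

End DiagonalFlat.

(** * Flat dimension of injective modules over a group ring *)

Section BaseFlat.
Variables (k : comPzRingType) (G : groupType) (X : choiceType).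
Local Notation kG := (group_ring k G).
Local Notation F := (free_module (group_ring k G) X).

Definition gr_coef (g : G) (y : kG) : k := (y : {malg k[G]})@_g.

Lemma gr_coefD g y z : gr_coef g (y + z) = gr_coef g y + gr_coef g z.
Proof. exact: mcoeffD. Qed.
Lemma gr_coefU g c h : gr_coef g (gr_monom c h) = c *+ (h == g).
Proof. exact: mcoeffU. Qed.
Lemma gr_coef0 g : gr_coef g 0 = 0.
Proof. exact: mcoeff0. Qed.

Lemma gr_coefZ (c : k) g (y : kG) : gr_coef g (gr_const G c * y) = c * gr_coef g y.
Proof.
elim/gr_ind: y => [|y z Hy Hz|d h]; first by rewrite mulr0 gr_coef0 mulr0.
  by rewrite mulrDr !gr_coefD Hy Hz mulrDr.
by rewrite gr_monomM !gr_coefU mul1g mulrnAr.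
Qed.

Lemma ex_base_coef (i : X * G) : exists c : {linear base_module F -> k^o},
  forall n : F, c n = gr_coef i.2 (free_coef i.1 n).
Proof.
apply: exists_lin => c u v.
apply: etrans (f_equal (gr_coef i.2) (free_coefD i.1 (gr_const G c *: u) v)) _.
by rewrite gr_coefD; congr (_ + _); rewrite free_coefZ gr_coefZ.
Qed.

Lemma base_free_flat : flat_module (base_module F).
Proof.
pose c i := sval (cid (ex_base_coef i)).
have cE i (n : F) : c i n = gr_coef i.2 (free_coef i.1 n) by rewrite /c; case: cid.
pose e (i : X * G) : base_module F := free_gen (gr_monom 1 i.2) i.1.
apply: (@dual_basis_flat k (base_module F) _ e c) => n.
elim/free_ind: n => [|u v|r x]; [exact: expands0|exact: expandsD|].
elim/gr_ind: r => [|u v Hu Hv|d h].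
- by rewrite free_gen0; apply: expands0.
- by rewrite free_genD; apply: expandsD Hu Hv.
exists [fset (x, h)]%fset => s /fsubsetP/(_ (x, h)); rewrite in_fset1 eqxx => /(_ isT) xs.
have cU y g : c (y, g) (free_gen (gr_monom d h) x) = d *+ ((x, h) == (y, g)).
  rewrite cE /= free_coefU xpair_eqE.
  by case: eqP => _ /=; [rewrite mulr1n gr_coefU|rewrite mulr0n gr_coef0].
rewrite (big_fsetD1 (x, h)) //= big_seq big1 => [|[y g]].
  apply: etrans (esym (addr0 _)); apply: etrans _ (f_equal (fun a : k => a *: e (x, h)) (esym (cU x h))).
  rewrite eqxx mulr1n; apply: esym; apply: etrans (free_genZ _ _ _) _.
  by rewrite gr_monomM mul1g mulr1.
rewrite in_fsetD1 => /andP[/negPf ix _].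
apply: etrans (f_equal (fun a : k => a *: e (y, g)) (cU y g)) _.
by rewrite eq_sym ix mulr0n scale0r.
Qed.

End BaseFlat.

Section GroupRingDim.
Variables (k : comPzRingType) (G : groupType).
Local Notation kG := (group_ring k G).

Lemma base_dim_shift n (N' F N : lmodType kG) (a : {linear N' -> F}) (b : {linear F -> N}) :
    ses a b -> flat_module (base_module F) ->
  tor_dim_le n.+1 (base_module N) <-> tor_dim_le n (base_module N').
Proof. by move=> ab Ff; apply: tor_dim_shift (base_ses ab) Ff. Qed.

(** Tensoring a free presentation of [U] with [W] gives a presentation of
    [diag W U] by a flat module, and it stays exact because [U] is flat over
    k. *)
Lemma diag_dim_flat r (W U : lmodType kG) :
    flat_module (base_module W) -> flat_module (base_module U) -> tor_dim_le r U ->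
  tor_dim_le r (diag W U).
Proof.
move=> Wf; elim: r => [|r IH] in U *.
  by move=> _ /tor_dim0 Uf X; apply/tor_zero_flat/diag_flat.
move=> Uf Ud; have [K [a [b ab]]] := free_ses U.
have Ff := @free_flat kG U; have Fbf := @base_free_flat k G U.
have [a' [b' ab']] := diag_ses_r W ab Uf.
apply/(tor_dim_shift _ ab' (diag_flat Wf Ff))/IH.
  by apply/tor_dim0/(base_dim_shift _ ab Fbf)/tor_dimS => X; apply: tor_zero_flat.
exact/(tor_dim_shift _ ab Ff).
Qed.

(** Each step of a free resolution of [W] contributes an extension whose middle
    term is bounded by [diag_dim_flat]; after [s] steps the syzygy is flat over
    k. *)
Lemma diag_dim s r (W U : lmodType kG) :
    tor_dim_le s (base_module W) -> flat_module (base_module U) -> tor_dim_le r U ->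
  tor_dim_le (s + r) (diag W U).
Proof.
move=> Wd Uf Ud; elim: s => [|s IH] in W Wd *.
  by apply: diag_dim_flat => //; apply: tor_dim0.
have [K [a [b ab]]] := free_ses W; have Fbf := @base_free_flat k G W.
have [a' [b' ab']] := diag_ses_l ab Uf.
move=> X; apply: tor_zero_coker ab' _ _.
  by apply: IH; apply/(base_dim_shift _ ab Fbf).
apply: (@tor_dim_leq _ r); first by rewrite leqW // leq_addl.
exact: diag_dim_flat.
Qed.

(** Induction from k to kG is the diagonal tensor product of a module with
    trivial action and the regular module, and it preserves monomorphisms. *)
Lemma base_injective (E : lmodType kG) :
  injective_module E -> injective_module (base_module E).
Proof.
move=> Ei A B i g iI.
pose aug : {rmorphism kG -> k} := @gr_aug k G.
pose F := free_module kG unit.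
have [a [aE aI]] : exists (a : {linear diag (restr aug A) F -> diag (restr aug B) F}),
    (forall w u, a (dt w u) = dt (restr_lin aug i w) u) /\ injective a.
  have [a [aE aE']] := ex_diag_map (restr_lin aug i) (idfun : {linear F -> F}).
  exists a; split=> // s t; rewrite !aE' !lmap_base.
  by apply: base_free_flat.
pose cf (u : F) : kG := free_coef tt u.
have gZ c (w : A) : g (c *: w) = gr_const G c *: (g w : E) by apply: (linearZZ g).
have augZ (V : lmodType k) (x : kG) (w : V) :
  @GRing.scale kG (restr aug V) x w = aug x *: w by [].
have augU (V : lmodType k) c x (w : V) :
  @GRing.scale kG (restr aug V) (gr_monom c x) w = c *: w by rewrite augZ /aug /= gr_augU.
have [h hE] : exists h : {additive diag (restr aug A) F -> E},
    forall (w : restr aug A) u, h (dt w u) = cf u *: (g w : E).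
  apply: ex_diag_lift => [w w' u|w u u'|c w u].
  - by rewrite raddfD scalerDr.
  - by rewrite -scalerDl -free_coefD.
  - apply: etrans (f_equal (fun v => cf u *: (v : E)) (etrans (f_equal g (augU _ c _ w)) (gZ c w))) _.
    by rewrite scalerA -gr_constC /cf free_coefZ.
have [|l lE] := @exists_lin kG (diag (restr aug A) F) E h.
  apply: gr_linear => c x.
  apply: (diag_hom_eq (f := h \o ( *:%R (gr_monom c x))) (g := ( *:%R (gr_monom c x)) \o h)).
  move=> w u /=; apply: etrans (f_equal h (diagZ c x w u)) _; apply: etrans (hE _ _) _.
  apply: etrans (f_equal (fun v => cf _ *: (v : E)) (etrans (f_equal g (augU _ c x w)) (gZ c w))) _.
  apply: etrans _ (f_equal ( *:%R (gr_monom c x)) (esym (hE w u))).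
  by rewrite /cf free_coefZ !scalerA -gr_constC mulrA -gr_monom_const.
have [m mE] := Ei _ _ a l aI.
pose one : F := free_gen 1 tt.
pose bt (y : restr aug B) : diag (restr aug B) F := dt y one.
have [|n nE] := @exists_lin k B (base_module E) (fun y : B => m (bt y)).
  move=> r y z; apply: etrans (f_equal m (@dtDl _ _ (restr aug B) F (r *: y) z one)) _.
  rewrite raddfD /=; congr (_ + _); rewrite baseZ -linearZZ; congr (m _).
  apply: esym; apply: etrans (diagZk _ _ _) _; congr (dt _ one); exact: augU.
exists n => x; rewrite nE; apply: etrans (f_equal m (esym (aE x one))) _.
apply: etrans (mE _) _; apply: etrans (lE _) _; apply: etrans (hE _ _) _.
by rewrite /cf /one free_coefU eqxx scale1r.
Qed.

(** The trivial module embeds in A compatibly with every tensor product over k,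
    so E embeds in its diagonal tensor product with A. *)
Lemma retract_diag (A E : lmodType kG) (iota : {linear trivial_module k G -> A}) :
    injective_module E -> pure_mono (base_map iota) ->
  exists (p : {linear E -> diag E A}) (q : {linear diag E A -> E}), forall x, q (p x) = x.
Proof.
move=> Ei [_ pureI].
pose u : trivial_module k G := (1 : k); pose e : A := iota u.
have uZ c x : gr_monom c x *: u = (c : trivial_module k G).
  by apply: etrans (f_equal (fun d : k => d * 1) (gr_augU c x)) (mulr1 c).
have eZ x : gr_monom 1 x *: e = e by rewrite /e -linearZZ uZ.
have [|p0 p0E] := @exists_add E (diag E A) (fun v => dt v e).
  by move=> v w; apply/eqP; rewrite eq_sym subr_eq; apply/eqP; rewrite -dtDl subrK.
have [|p pE] := @exists_lin kG E (diag E A) p0.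
  by apply: gr_linear => c x v; rewrite !p0E diagZ eZ.
have pI : injective p.
  move=> v w; rewrite !pE !p0E => vw.
  have [h hE] : exists h : {additive tensor (rbase E) (base_module (trivial_module k G)) -> E},
      forall v c, h (tens v c) = gr_const G (c : k) *: (v : E).
    apply: ex_tensor_lift; split=> [x y c|x c d|x r c].
    - exact: scalerDr.
    - by rewrite -scalerDl -raddfD.
    - rewrite scalerA -rmorphM; congr (gr_const G _ *: _).
      by rewrite mulrC; apply: f_equal2 (esym (gr_augU r 1%g)) _.
  pose tu (x : rbase E) := @tens k _ (base_module (trivial_module k G)) x u.
  have hu (x : E) : h (tu x) = x by apply: etrans (hE x u) (scale1r _).
  have rE x : rmap (rbase E) (base_map iota) (tu x) = dt (x : E) e.
    exact: tensor_map_tens.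
  apply: etrans (esym (hu v)) (etrans _ (hu w)); congr (h _).
  by apply: (pureI (rbase E)); apply: etrans (rE v) (etrans vw (esym (rE w))).
have [q qE] := Ei _ _ p idfun pI.
by exists p, q.
Qed.

(** An injective [E] is a direct summand of [diag E A], and its flat dimension
    over k is bounded because it is injective over k. *)
Lemma group_ring_left_dim s r (A : lmodType kG) (iota : {linear trivial_module k G -> A}) :
    sfli_le k s -> flat_module (base_module A) -> fd_le A r ->
    pure_mono (base_map iota) ->
  forall E : lmodType kG, injective_module E -> tor_dim_le (s + r) E.
Proof.
move=> ks Af Ad iP E Ei X; have [p [q qp]] := retract_diag Ei iP.
apply: (tor_zero_retract qp); apply: diag_dim => //; last exact: fd_tor_dim.
by apply/fd_tor_dim/ks/base_injective.
Qed.

End GroupRingDim.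

Section Antipode.
Variables (k : comPzRingType) (G : groupType).
Local Notation kG := (group_ring k G).

Lemma antipode_comp x : antipode k G x = antipode' k G x.
Proof. by rewrite antipodeE antipode'E. Qed.
Lemma antipode'K x : antipode k G (antipode' k G x) = x.
Proof. by rewrite antipodeE antipode'E antipodeK. Qed.
Lemma antipodeK' x : antipode' k G (antipode k G x) = x.
Proof. by rewrite antipodeE antipode'E antipodeK. Qed.

Lemma antipode'_surj (r : kG) : exists s, antipode' k G s = r.
Proof. by exists (antipode k G r); rewrite antipodeK'. Qed.

Lemma to_right_flat (F : lmodType kG) : flat_module F -> flat_right (to_right F).
Proof.
move=> Ff A B f fI; apply: (swap_rmap_inj antipode_comp antipode'_surj).
have [|p pE] := @exists_lin kG (restr (antipode k G) (to_right F)) F id.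
  move=> x u v; congr (_ + _).
  by apply: (f_equal (fun y : kG => y *: (u : F))); apply: antipodeK'.
have [|q qE] := @exists_lin kG F (restr (antipode k G) (to_right F)) id.
  move=> x u v; congr (_ + _).
  by apply: (f_equal (fun y : kG => y *: (u : F))); apply/esym/antipodeK'.
have F'f : flat_module (restr (antipode k G) (to_right F)).
  by apply: (flat_retract (p := p) (q := q)) Ff => n; rewrite qE pE.
exact: F'f.
Qed.

(** The antipode exchanges the two factors of a tensor product and preserves
    free modules, so it exchanges the two variables of Tor. *)
Lemma tor_zero_swap i (J : lmodType kG^c) (N : lmodType kG) :
  tor_zero i (to_right N) (to_left J) -> tor_zero i J N.
Proof.
elim: i => [|i IH] in N *; have [K [a [b ab]]] := free_ses N;
  have Ff := @free_flat kG N; have Fr := to_right_flat Ff => T.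
- have ab' : ses (restr_lin (antipode' k G) a) (restr_lin (antipode' k G) b).
    by case: ab.
  apply: (tor0_of_r ab Ff); apply: (swap_rmap_inj antipode_comp antipode'_surj).
  exact: T Fr ab'.
- have ab' : ses (restr_lin (antipode' k G) a) (restr_lin (antipode' k G) b).
    by case: ab.
  by apply/(tor_shift_r _ _ ab Ff)/IH; apply: T Fr ab'.
Qed.

Lemma to_left_injective (J : lmodType kG^c) :
  injective_module J -> injective_module (to_left J).
Proof.
move=> Ji A B i g iI.
have [|g' g'E] := @exists_lin kG^c (to_right A) J g.
  move=> x u v; apply: etrans (linearP g (antipode' k G x) u v) _.
  congr (_ + _); apply: (f_equal (fun y : kG^c => y *: (g u : J))); exact: antipode'K.
have [h hE] := Ji _ _ (restr_lin (antipode' k G) i) g' iI.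
have [|h' h'E] := @exists_lin kG B (to_left J) h.
  move=> x u v; apply: etrans _ (linearP h (antipode k G x) u v).
  congr (h (_ + _)); apply: (f_equal (fun y : kG => y *: (u : B))).
  exact/esym/antipodeK'.
by exists h' => x; rewrite h'E; apply: etrans (hE x) (g'E x).
Qed.

End Antipode.

Theorem corollary3p18 (k : comPzRingType) (G : groupType)
    (sfli_k : sfli_finite k)
    (weak_char : exists A : lmodType (group_ring k G), weak_characteristic A)
    (M : lmodType (group_ring k G)) :
  gorenstein_flat M <->
  gorenstein_injective (pontryagin_dual M : lmodType (group_ring k G)^c).
Proof.
split; first exact: gorenstein_injective_dual.
have [s ks] := sfli_k; have [A [Af [r Ad] [iota iP]]] := weak_char.
have dim := group_ring_left_dim ks Af Ad iP.
apply: gorenstein_flat_of_dual; first by exists (s + r)%N.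
move=> J Ji; exists (s + r)%N => N; apply: tor_zero_swap.
exact: dim (to_left_injective Ji) _.
Qed.
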